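(* Let $X$ be a compact metric space with distance $d$. Assume that $f:X\to X$ is a continuous transformation and that there exist constants $\delta,\lambda,\Lambda>0$ such that $$\lambda\, d(x,y)\le d(f(x),f(y))\le \Lambda\, d(x,y)$$ for every $x,y\in X$ with $d(x,y)<\delta$. If $\mu$ is an $f$-invariant ergodic probability measure with positive metric entropy $h_\mu(f)>0$, then $$\frac{h_\mu(f)}{\log\Lambda}\le\underline R(x)\qquad\text{and}\qquad \overline R(x)\le\frac{h_\mu(f)}{\log\lambda},$$ and $$\frac{1}{\log\Lambda}\le\underline S(x)$$ for $\mu$-almost every $x\in X$. If, in addition, $f$ satisfies the specification property, then $\overline S(x)\le \dfrac{1}{\log\lambda}$ for $\mu$-almost every $x\in X$.
   Context: $B(x,r)$ denotes the metric ball of radius $r$ centered at $x$. For a set $A\subset X$, $R_A(x)=\inf\{k\ge 1: f^k(x)\in A\}$ and $S(A)=\inf\{k\ge 1: f^{-k}(A)\cap A\ne\emptyset\}$. The pointwise recurrence rates are $$\overline R(x)=\limsup_{r\to 0}\frac{\log R_{B(x,r)}(x)}{-\log r},\qquad \underline R(x)=\liminf_{r\to 0}\frac{\log R_{B(x,r)}(x)}{-\log r},$$ and the minimal recurrence rates are $$\overline S(x)=\limsup_{r\to 0}\frac{S(B(x,r))}{-\log r},\qquad \underline S(x)=\liminf_{r\to 0}\frac{S(B(x,r))}{-\log r}.$$ Specification property: for every $\delta>0$ (here an arbitrary number, unrelated to the constant in the claim) there is an integer $N=N(\delta)\ge 1$ such that for any $k\ge 1$, any points $x_1,\dots,x_k\in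 X$, any integers $0=a_1\le b_1<a_2\le b_2<\dots<a_k\le b_k$ satisfying $a_{i+1}-b_i>N(\delta)$, and any integer $p\ge b_k+N(\delta)$, there exists a point $x\in X$ such that $f^p(x)=x$ and $d(f^j(x),f^j(x_i))<\delta$ for every $a_i\le j\le b_i$ and $1\le i\le k$.
   Formalization: The two upper bounds, by h/log λ and by 1/log λ, are stated only for λ > 1; for λ < 1 they are always false, since the rates are nonnegative and the quotients negative (e.g. the doubling map with λ = 1/2), and for λ = 1 the quotients are undefined. *)

(* Defs.v *)
From HB Require Import structures.
From mathcomp Require Import all_boot all_order all_algebra.
From mathcomp Require Import all_classical all_reals all_analysis.

Set Implicit Arguments.
Unset Strict Implicit.
Unset Printing Implicit Defensive.

Import Order.TTheory GRing.Theory Num.Theory.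
Import numFieldNormedType.Exports.

Local Open Scope classical_set_scope.
Local Open Scope ring_scope.

(* MathComp-Analysis builds generated sigma-algebras on pointed types only; a
   space carrying a probability measure is nonempty, so asking for a point is
   no restriction. *)
#[short(type="pmetricType")]
HB.structure Definition PointedMetric (K : numDomainType) :=
  { M of Pointed M & Metric K M }.

Notation borel X := (g_sigma_algebraType (@open X)).

Section MeasurePreserving.
Context (d : measure_display) (T : measurableType d) (R : realType).
Implicit Types (mu : probability T R) (f : T -> T).

Definition invariant_measure mu f : Prop :=
  forall A : set T, measurable A -> mu (f @^-1` A) = mu A.

Definition ergodic_measure mu f : Prop :=
  forall A : set T, measurable A -> f @^-1` A = A ->
    mu A = 0%E \/ mu A = 1%E.

(* Atoms are indexed, and some of them may be empty. *)
Definition measurable_partition (I : finType) (P : I -> set T) : Prop :=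
  [/\ forall i, measurable (P i),
      trivIset [set: I] P &
      \bigcup_i P i = [set: T]].

(* H_mu(P) = - sum_i mu(P_i) log mu(P_i); the convention 0 log 0 = 0 holds
   because the library sets ln 0 = 0. *)
Definition partition_entropy mu (I : finType) (P : I -> set T) : R :=
  - \sum_(i : I) fine (mu (P i)) * ln (fine (mu (P i))).

(* P \/ f^-1 P \/ ... \/ f^-(n-1) P, with atoms indexed by itineraries. *)
Definition iterated_join f (I : finType) (P : I -> set T) (n : nat)
    (w : {ffun 'I_n -> I}) : set T :=
  \bigcap_(j : 'I_n) (iter j f @^-1` P (w j)).

(* The limit exists, by subadditivity, when P is a measurable partition and mu
   is f-invariant. *)
Definition entropy_rate mu f (I : finType) (P : I -> set T) : R :=
  limn (fun n : nat =>
    partition_entropy mu (iterated_join f P (n := n)) / n%:R).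

Definition metric_entropy mu f : \bar R :=
  ereal_sup [set h | exists (k : nat) (P : 'I_k -> set T),
    measurable_partition P /\ h = (entropy_rate mu f P)%:E].

End MeasurePreserving.

(* +oo when E is empty. *)
Definition inf_nat (R : realType) (E : set nat) : \bar R :=
  ereal_inf [set (k%:R)%:E | k in E].

Section Recurrence.
Context (R : realType) (X : metricType R).
Implicit Types (f : X -> X) (A : set X) (x : X).

Definition return_time f A x : \bar R :=
  inf_nat R [set k | (1 <= k)%N /\ A (iter k f x)].

Definition set_return_time f A : \bar R :=
  inf_nat R [set k | (1 <= k)%N /\ (iter k f @^-1` A) `&` A !=set0].

Definition recurrence_ratio f x (r : R) : \bar R :=
  (lne (return_time f (ball x r) x) / (- ln r)%:E)%E.

Definition set_recurrence_ratio f x (r : R) : \bar R :=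
  (set_return_time f (ball x r) / (- ln r)%:E)%E.

Definition upper_recurrence_rate f x : \bar R :=
  limf_esup (recurrence_ratio f x) (0 : R)^'+.

Definition lower_recurrence_rate f x : \bar R :=
  limf_einf (recurrence_ratio f x) (0 : R)^'+.

Definition upper_minimal_recurrence_rate f x : \bar R :=
  limf_esup (set_recurrence_ratio f x) (0 : R)^'+.

Definition lower_minimal_recurrence_rate f x : \bar R :=
  limf_einf (set_recurrence_ratio f x) (0 : R)^'+.

(* The finite sequences are given by functions on nat of which only the values
   at 1, ..., k are used. *)
Definition specification_property f : Prop :=
  forall eps : R, 0 < eps ->
  exists N : nat, (1 <= N)%N /\
  forall (k : nat) (x : nat -> X) (a b : nat -> nat) (p : nat),
    (1 <= k)%N ->
    a 1%N = 0%N ->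
    (forall i, (1 <= i <= k)%N -> (a i <= b i)%N) ->
    (forall i, (1 <= i < k)%N -> (b i + N < a i.+1)%N) ->
    (b k + N <= p)%N ->
    exists y : X, iter p f y = y /\
      forall i j, (1 <= i <= k)%N -> (a i <= j <= b i)%N ->
        mdist (iter j f y) (iter j f (x i)) < eps.

End Recurrence.

(* Main.v *)
Require Import Defs.
From HB Require Import structures.
From mathcomp Require Import all_boot all_order all_algebra.
From mathcomp Require Import all_classical all_reals all_analysis.
From mathcomp Require Import measurable_realfun.
From mathcomp Require Import zify ring lra.

Import Order.TTheory GRing.Theory Num.Theory.
Import numFieldNormedType.Exports.

Local Open Scope classical_set_scope.
Local Open Scope ring_scope.

Set Implicit Arguments.
Unset Strict Implicit.
Unset Printing Implicit Defensive.

(** Write [h] for the metric entropy. The proof compares balls with cylinders, the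
    sets of points that share their first [n] symbols with respect to a finite
    observable, and studies the returns of cylinders by coding.

    Coding. By [gibbs], a subprobability on the words of length [n] bounds the
    entropy of these words by the mean of its negative logarithm. Three of them
    carry the proof. The Markov approximations show that [H n / n] converges
    ([rate_cvg]) and that almost every itinerary is eventually one of [exp (s n)]
    typical words, for any [s] above the entropy rate ([typical_words]). A
    letter-correcting code shows that the entropy rate depends continuously on
    the observable ([rate_compare]). A block code shows that the entropy rate is
    at most [c] if most points start with a block which, given its future, is
    one of [exp (c n)] ([rate_le_block_code]).

    Returns of cylinders. A set has a subset of measure at most [1 / K] without
    return before time [K]; as there are few typical words, almost every point
    returns to its cylinder of length [n] before [exp (s n)]
    ([eventually_returns]). Conversely a block that returns before [exp (c n)] is
    determined by its return time and its future, and a block with a period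
    [k <= c n] by its first [k] letters. If this happened at infinitely many [n]
    on a set of positive measure, then, by ergodicity, it would happen almost
    everywhere, and the block code would bring the entropy rate below itself
    ([eventually_no_return], [eventually_no_overlap]).

    Balls. If [f] expands by [lam > 1], the cylinder of length [n] of an
    observable with small atoms is contained in a ball of radius of order
    [lam ^ (- n)]: this yields the upper bound on the recurrence rate
    ([expanding_upper]). For the lower bounds a ball of radius about
    [Lam ^ (- n)] must be contained in a cylinder of length [n]. This holds
    almost everywhere when orbits do not approach the boundaries of the atoms at
    some small exponential speed, and observables with this property have entropy
    rates arbitrarily close to [h] ([thick_observable], [lipschitz_lower], [lipschitz_lower_minimal]).
    The last bound holds at every point: the specification property provides a
    point of period [n + N] in the ball of radius of order [lam ^ (- n)]
    ([specification_upper]). *)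

(** * Words over a finite alphabet and subprobability codes *)

Lemma ler_sum_mem (R : numDomainType) (T : eqType) (s : seq T) (F G : T -> R) :
  (forall i, i \in s -> F i <= G i) ->
  \sum_(i <- s) F i <= \sum_(i <- s) G i.
Proof. by move=> FG; rewrite !big_seq; apply: ler_sum. Qed.

Section Words.
Variable A : finType.

Fixpoint words n : seq (seq A) :=
  if n is n'.+1 then [seq a :: w | a <- enum A, w <- words n'] else [:: [::]].

Lemma mem_words n w : (w \in words n) = (size w == n).
Proof.
elim: n w => [|n IH] [|a w] //=; rewrite ?inE//.
  by apply/allpairsP => -[[b v] /= []].
rewrite eqSS -IH; apply/allpairsP/idP => [[[b v] /= [_ vn [_ ->]]]//|wn].
by exists (a, w); rewrite mem_enum.
Qed.

Lemma uniq_words n : uniq (words n).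
Proof.
elim: n => [//|n IH] /=; apply: allpairs_uniq => //; first exact: enum_uniq.
by move=> [a u] [b v] _ _ /= [-> ->].
Qed.

Variable R : realType.
Implicit Types F G : seq A -> R.

Lemma sum_words0 F : \sum_(w <- words 0) F w = F [::].
Proof. by rewrite /words big_seq1. Qed.

Lemma sum_wordsS n F :
  \sum_(w <- words n.+1) F w = \sum_(a : A) \sum_(w <- words n) F (a :: w).
Proof. by rewrite /= big_allpairs_dep big_enum. Qed.

Lemma sum_words_cat m n F :
  \sum_(w <- words (m + n)) F w =
  \sum_(u <- words m) \sum_(v <- words n) F (u ++ v).
Proof.
elim: m F => [|m IH] F; first by rewrite sum_words0.
by rewrite addSn !sum_wordsS; apply: eq_bigr => a _; rewrite IH.
Qed.

Lemma ler_sum_words n F G : (forall w, size w = n -> F w <= G w) ->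
  \sum_(w <- words n) F w <= \sum_(w <- words n) G w.
Proof.
by move=> FG; apply: ler_sum_mem => w; rewrite mem_words => /eqP /FG.
Qed.

Lemma eq_sum_words n F G : (forall w, size w = n -> F w = G w) ->
  \sum_(w <- words n) F w = \sum_(w <- words n) G w.
Proof.
move=> FG; apply: eq_big_seq => w; by rewrite mem_words => /eqP /FG.
Qed.

Lemma count_le_inj (T : eqType) (P : pred (seq A)) (s : seq T)
    (h : seq A -> T) n :
  (forall w, size w = n -> P w -> h w \in s) ->
  (forall u v, size u = n -> size v = n -> P u -> P v -> h u = h v -> u = v) ->
  (count P (words n) <= size s)%N.
Proof.
move=> hs hI; rewrite -size_filter -(size_map h); apply: uniq_leq_size.
  rewrite map_inj_in_uniq ?filter_uniq ?uniq_words// => u v.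
  rewrite !mem_filter !mem_words => /andP[Pu /eqP su] /andP[Pv /eqP sv].
  exact: hI.
move=> x /mapP[w]; rewrite mem_filter mem_words => /andP[Pw /eqP sw] ->.
exact: hs.
Qed.

Lemma sum_pred_words (P : pred (seq A)) n :
  \sum_(w <- words n) (P w)%:R = (count P (words n))%:R :> R.
Proof. by rewrite -sum1_count natr_sum [RHS]big_mkcond; apply: eq_bigr => w _; case: (P w). Qed.

Lemma size_words n : size (words n) = (#|A| ^ n)%N.
Proof. by elim: n => [//|n IH]; rewrite size_allpairs -cardE IH expnS. Qed.

End Words.

Arguments words : simpl never.

Section Gibbs.
Variables (R : realType) (T : eqType).

Lemma le_lnB1 (x : R) : 0 < x -> ln x <= x - 1.
Proof.
move=> x0; rewrite -{1}(addrNK 1 x) addrC; apply: le_ln1Dx.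
by rewrite -subr_gt0; lra.
Qed.

(** Nonnegativity of relative entropy. Every entropy bound below is an instance
    of it: to bound the entropy of the words of length [n], exhibit a
    subprobability [q] on them for which [- ln q] is small on average. *)
Lemma gibbs (s : seq T) (p q : T -> R) :
  (forall i, i \in s -> 0 <= p i) -> (forall i, i \in s -> 0 <= q i) ->
  (forall i, i \in s -> 0 < p i -> 0 < q i) ->
  \sum_(i <- s) q i <= \sum_(i <- s) p i ->
  - (\sum_(i <- s) p i * ln (p i)) <= \sum_(i <- s) p i * - ln (q i).
Proof.
move=> p0 q0 pq qp; rewrite lerNl -sumrN -subr_ge0 -sumrB.
apply: le_trans (_ : 0 <= \sum_(i <- s) (p i - q i)) _.
  by rewrite sumrB subr_ge0.
apply: ler_sum_mem => i si; have := p0 _ si.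
rewrite le_eqVlt => /predU1P[<-|pi0]; first by rewrite !mul0r oppr0 sub0r subr0 oppr_le0 q0.
have qi0 := pq _ si pi0.
have := ler_wpM2l (ltW pi0) (le_lnB1 (divr_gt0 qi0 pi0)).
have -> : p i * (q i / p i - 1) = q i - p i by field; rewrite gt_eqF.
rewrite ln_div ?posrE//; lra.
Qed.

End Gibbs.

(** The subprobability of a block code. A word is read from the left, either one
    letter at a time, each letter costing [ln (2 * #|A|)], or by blocks [u]
    which the codebook [D u v] allows in front of the remaining word [v]; a
    block of length [n] costs [g * n]. The weight of a word is the sum over all
    its parsings of [exp] of minus the cost, so that no parsing has to be
    counted or chosen. *)
Section BlockCode.
Variables (A : finType) (R : realType).
Variables (D : seq A -> seq A -> bool) (g : R) (M M' : nat).
Hypothesis M_gt0 : (0 < M)%N.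

Let beta : R := (2 * #|A|%:R)^-1.

(* [k] is fuel, needed because a block may have any length *)
Fixpoint code_rec k (w : seq A) : R :=
  if k is k'.+1 then
    if w is [::] then 1 else
    beta * code_rec k' (behead w) +
    \sum_(n <- iota M M' | (n <= size w)%N && D (take n w) (drop n w))
       expR (- (g * n%:R)) * code_rec k' (drop n w)
  else 1.

Definition block_code w := code_rec (size w) w.

Let beta_ge0 : 0 <= beta.
Proof. by rewrite invr_ge0 mulr_ge0. Qed.

Lemma code_rec_fuel k w : (size w <= k)%N -> code_rec k w = block_code w.
Proof.
rewrite /block_code; move: {-1}(size w) (leqnn (size w)) => l.
elim: k l w => [|k IH] [|l] [|a w] //= wl wk.
congr (_ * _ + _).
  by rewrite (IH l).  
rewrite [LHS]big_seq_cond [RHS]big_seq_cond; apply: eq_bigr => n /andP[].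
rewrite mem_iota => /andP[Mn _] _; congr (_ * _).
have sd : (size (drop n (a :: w)) <= size w)%N.
  by rewrite size_drop leq_subLR -[size (a :: w)]add1n leq_add2r (leq_trans M_gt0 Mn).
by rewrite (IH l) ?(leq_trans sd).
Qed.

Lemma block_code_cons a w : block_code (a :: w) =
  beta * block_code w +
  \sum_(n <- iota M M' | (n <= size (a :: w))%N &&
      D (take n (a :: w)) (drop n (a :: w)))
     expR (- (g * n%:R)) * block_code (drop n (a :: w)).
Proof.
rewrite {1}/block_code /=; congr (_ + _).
rewrite [LHS]big_seq_cond [RHS]big_seq_cond; apply: eq_bigr => n /andP[].
rewrite mem_iota => /andP[Mn _] _; rewrite code_rec_fuel//.
by rewrite size_drop leq_subLR -[size (a :: w)]add1n leq_add2r (leq_trans M_gt0 Mn).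
Qed.

Lemma block_code_ge0 w : 0 <= block_code w.
Proof.
rewrite /block_code; move: (size w) => k; elim: k w => [|k IH] [|a w] //=.
by rewrite addr_ge0 ?mulr_ge0// sumr_ge0// => n _; rewrite mulr_ge0// expR_ge0.
Qed.

Lemma block_code_letter a w : beta * block_code w <= block_code (a :: w).
Proof.
rewrite block_code_cons lerDl sumr_ge0// => n _.
by rewrite mulr_ge0 ?expR_ge0 ?block_code_ge0.
Qed.

Lemma block_code_block u v : (M <= size u < M + M')%N -> D u v ->
  expR (- (g * (size u)%:R)) * block_code v <= block_code (u ++ v).
Proof.
case: u => [|a u] uM Duv; first by move: uM; rewrite leqNgt M_gt0.
have um : size (a :: u) \in iota M M' by rewrite mem_iota.
rewrite cat_cons block_code_cons (big_rem (size (a :: u)))//= -cat_cons.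
rewrite take_size_cat// drop_size_cat// Duv size_cat leq_addr /=.
rewrite addrCA lerDl addr_ge0 ?mulr_ge0 ?block_code_ge0//.
by rewrite sumr_ge0// => n _; rewrite mulr_ge0 ?expR_ge0 ?block_code_ge0.
Qed.

Lemma block_code_gt0 w : (0 < #|A|)%N -> 0 < block_code w.
Proof.
move=> A0; elim: w => [|a w IH]; first exact: ltr01.
apply: lt_le_trans (block_code_letter a w).
by rewrite mulr_gt0// invr_gt0 mulr_gt0// ltr0n.
Qed.

Variables (c eps : R).
Hypothesis gE : g = c + eps.
Hypothesis D_count : forall n v, (M <= n < M + M')%N ->
  \sum_(u <- words A n) (D u v)%:R <= expR (c * n%:R).
Hypothesis M_large : \sum_(n <- iota M M') expR (- (eps * n%:R)) <= 2^-1.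

(** Half of the mass goes to the letters, and at most [\sum_n exp (- eps n)],
    hence the other half, to the blocks: given the future there are at most
    [exp (c n)] blocks of length [n], each of weight [exp (- (c + eps) n)]. *)
Lemma block_code_sum L : \sum_(w <- words A L) block_code w <= 1.
Proof.
elim/ltn_ind: L => -[_|L IH]; first by rewrite sum_words0.
have hsplit : forall w : seq A, size w = L.+1 -> block_code w =
    beta * block_code (behead w) +
    \sum_(n <- iota M M' | (n <= L.+1)%N)
      (D (take n w) (drop n w))%:R * (expR (- (g * n%:R)) * block_code (drop n w)).
  case=> [//|a w] sw; rewrite block_code_cons sw; congr (_ + _).
  rewrite big_mkcondr; apply: eq_bigr => n _.
  by case: ifP => _; rewrite (mul1r, mul0r).
rewrite (eq_sum_words hsplit) big_split /=.
apply: (@le_trans _ _ (2^-1 + 2^-1)); last by lra.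
apply: lerD.
  rewrite sum_wordsS /= sumr_const -mulr_sumr -[leLHS]mulr_natl mulrA.
  apply: le_trans (_ : #|A|%:R * beta * 1 <= _).
    by rewrite ler_wpM2l ?IH// mulr_ge0// ler0n.
  rewrite mulr1 /beta; case: (posnP #|A|) => [->|A0]; first by rewrite mul0r invr_ge0.
  by rewrite invfM mulrCA divff ?mulr1// pnatr_eq0 -lt0n.
apply: le_trans M_large.
rewrite exchange_big big_mkcond /=; apply: ler_sum_mem => n.
rewrite mem_iota => nM; case: ifP => [nL|_]; last exact: expR_ge0.
have n0 : (0 < n)%N by case/andP: nM => /(leq_trans M_gt0).
rewrite -{1}(subnKC nL) sum_words_cat.
rewrite (@eq_sum_words _ _ _ _ (fun u => \sum_(v <- words A (L.+1 - n))
  (D u v)%:R * (expR (- (g * n%:R)) * block_code v))); last first.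
  move=> u su; apply: eq_bigr => v _.
  by rewrite take_size_cat// drop_size_cat.
rewrite exchange_big /=.
apply: le_trans (_ : \sum_(v <- words A (L.+1 - n))
   expR (- (eps * n%:R)) * block_code v <= _).
  apply: ler_sum => v _; rewrite -mulr_suml mulrA ler_wpM2r ?block_code_ge0//.
  apply: le_trans (_ : expR (c * n%:R) * expR (- (g * n%:R)) <= _).
    by rewrite ler_wpM2r ?expR_ge0// D_count.
  by rewrite -expRD gE mulrDl opprD addNKr ?addrA ?subrr ?add0r.
rewrite -mulr_sumr ler_piMr ?expR_ge0// IH// ltn_subrL n0 //.
Qed.

End BlockCode.

(** * Real-valued probabilities and bounded measurable functions *)

Section RealProbability.
Context (d : measure_display) (T : measurableType d) (R : realType).
Variable mu : probability T R.
Implicit Types (A B : set T) (g h : T -> R).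

Definition pr A : R := fine (mu A).

Lemma prE A : measurable A -> mu A = (pr A)%:E.
Proof.
move=> mA; rewrite /pr fineK// ge0_fin_numE ?measure_ge0//.
exact: le_lt_trans (probability_le1 mu mA) (ltry 1).
Qed.

Lemma pr_ge0 A : 0 <= pr A.
Proof. by rewrite fine_ge0. Qed.

Lemma pr_setT : pr setT = 1.
Proof. by rewrite /pr probability_setT. Qed.

Lemma le_pr A B : measurable A -> measurable B -> A `<=` B -> pr A <= pr B.
Proof. by move=> mA mB AB; rewrite -lee_fin -!prE// le_measure// inE. Qed.

Lemma pr_setC A : measurable A -> pr (~` A) = 1 - pr A.
Proof.
move=> mA; apply/eqP; rewrite -eqe -prE; last exact: measurableC.
by rewrite EFinB -prE// -probability_setC.
Qed.

Lemma prU_le A B : measurable A -> measurable B ->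
  pr (A `|` B) <= pr A + pr B.
Proof.
move=> mA mB; rewrite -lee_fin EFinD -!prE//; last exact: measurableU.
exact: measureU2.
Qed.

Lemma prU A B : measurable A -> measurable B -> [disjoint A & B] ->
  pr (A `|` B) = pr A + pr B.
Proof.
move=> mA mB dAB; apply/eqP; rewrite -eqe -prE ?EFinD -?prE//; last exact: measurableU.
by apply/eqP/measureU => //; exact/disj_set2P.
Qed.

Lemma pr_bigcup_decr (F : nat -> set T) (e : R) : (forall n, measurable (F n)) ->
  (forall n, F n.+1 `<=` F n) -> mu (\bigcap_n F n) = 0%E -> 0 < e ->
  exists n, pr (F n) < e.
Proof.
move=> mF decF F0 e0.
have cv : (mu \o F) n @[n --> \oo] --> mu (\bigcap_n F n).
  apply: nonincreasing_cvg_mu => //.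
  - exact: le_lt_trans (probability_le1 mu (mF 0%N)) (ltry 1).
  - exact: bigcapT_measurable.
  - apply/nonincreasing_seqP => n; apply/subsetPset; exact: decF.
move: cv; rewrite F0 => /fine_cvgP[_ /cvgrPdist_lt/(_ _ e0)[N _ /(_ N (leqnn N))]].
rewrite sub0r normrN ger0_norm ?fine_ge0//= => h.
by exists N.
Qed.

Lemma pr_bigcup_incr (F : nat -> set T) (e : R) : (forall n, measurable (F n)) ->
  (forall n, F n `<=` F n.+1) -> mu (~` \bigcup_n F n) = 0%E -> 0 < e ->
  exists n, pr (~` F n) < e.
Proof.
move=> mF incF F0 e0; apply: pr_bigcup_decr => //.
- by move=> n; exact: measurableC.
- by move=> n; exact: subsetC.
- by rewrite -setC_bigcup.
Qed.

Lemma borel_cantelli_geometric (F : nat -> set T) (C theta : R) :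
  (forall n, measurable (F n)) -> 0 <= theta < 1 ->
  (forall n, pr (F n) <= C * theta ^+ n) ->
  {ae mu, forall x, exists n0, forall n, (n0 <= n)%N -> ~ F n x}.
Proof.
move=> mF /andP[th0 th1] FC.
exists (lim_sup_set F); split.
- apply: bigcapT_measurable => n; apply: bigcup_measurable => k _; exact: mF.
- apply: lim_sup_set_cvg0 => //.
  have C0 : 0 <= C by have := le_trans (pr_ge0 (F 0%N)) (FC 0%N); rewrite expr0 mulr1.
  apply: le_lt_trans (ltry (C / (1 - theta))).
  apply: lime_le; first by apply: is_cvg_nneseries => n _ _; exact: measure_ge0.
  apply: nearW => n.
  rewrite (eq_bigr (fun i => (pr (F i))%:E)) => [|i _]; last exact: prE.
  rewrite sumEFin lee_fin; apply: (@le_trans _ _ (\sum_(0 <= i < n) C * theta ^+ i)).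
    by apply: ler_sum.
  have := @geometric_seriesE R C theta; rewrite lt_eqF// => /(_ isT).
  move/(congr1 (fun u : nat -> R => u n)); rewrite /series/= => ->.
  rewrite ler_wpM2r ?invr_ge0 ?subr_ge0 ?(ltW th1)// ler_piMr//.
  by rewrite gerBl exprn_ge0.
- move=> x /= H n _; apply: contrapT => nF; apply: H; exists n => k nk Fk.
  by apply: nF; exists k.
Qed.

(** Bounded measurable functions, the only ones that are integrated. *)
Definition bmeas g := measurable_fun setT g /\ exists M, forall x, `|g x| <= M.

Lemma bmeas_integrable g : bmeas g -> mu.-integrable setT (EFin \o g).
Proof.
move=> [mg [M gM]]; apply: measurable_bounded_integrable => //.
  exact: le_lt_trans (probability_le1 mu measurableT) (ltry 1).
exists M; split; first exact: num_real.
by move=> N MN x _ /=; exact: le_trans (gM x) (ltW MN).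
Qed.

Lemma bmeas_cst (c : R) : bmeas (fun=> c).
Proof. by split; [exact: measurable_cst|exists `|c|]. Qed.

Lemma bmeasD g h : bmeas g -> bmeas h -> bmeas (fun x => g x + h x).
Proof.
move=> [mg [M gM]] [mh [N hN]]; split; first exact: measurable_funD.
by exists (M + N) => x; rewrite (le_trans (ler_normD _ _))// lerD.
Qed.

Lemma bmeasZ (c : R) g : bmeas g -> bmeas (fun x => c * g x).
Proof.
move=> [mg [M gM]]; split; first exact: measurable_funM.
by exists (`|c| * M) => x; rewrite normrM ler_wpM2l.
Qed.

Lemma bmeas_max g h : bmeas g -> bmeas h -> bmeas (fun x => Num.max (g x) (h x)).
Proof.
move=> [mg [M gM]] [mh [N hN]]; split; first exact: measurable_maxr.
exists (Num.max M N) => x; rewrite le_max.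
by case: (leP (g x) (h x)) => _; rewrite ?gM ?hN ?orbT.
Qed.

Lemma bmeas_indic A : measurable A -> bmeas (\1_A : T -> R).
Proof.
move=> mA; split; first exact: measurable_indic.
by exists 1 => x; rewrite indicE; case: (_ \in _); rewrite ?normr1 ?normr0.
Qed.

Lemma bmeas_sum (I : Type) (s : seq I) (G : I -> T -> R) :
  (forall i, bmeas (G i)) -> bmeas (fun x => \sum_(i <- s) G i x).
Proof.
move=> mG; elim: s => [|i s IH].
  by under [X in bmeas X]funext => x do rewrite big_nil; exact: bmeas_cst.
by under [X in bmeas X]funext => x do rewrite big_cons; exact: bmeasD.
Qed.

Definition expect g : R := \int[mu]_x g x.

Lemma expect_cst (c : R) : expect (fun=> c) = c.
Proof. by rewrite /expect Rintegral_cst// -/(pr setT) pr_setT mulr1. Qed.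

Lemma expectD g h : bmeas g -> bmeas h ->
  expect (fun x => g x + h x) = expect g + expect h.
Proof. by move=> bg bh; rewrite /expect RintegralD//; exact: bmeas_integrable. Qed.

Lemma expectZ (c : R) g : bmeas g -> expect (fun x => c * g x) = c * expect g.
Proof. by move=> bg; rewrite /expect RintegralZl//; exact: bmeas_integrable. Qed.

Lemma le_expect g h : bmeas g -> bmeas h -> (forall x, g x <= h x) ->
  expect g <= expect h.
Proof.
by move=> bg bh gh; apply: le_Rintegral => //; exact: bmeas_integrable.
Qed.

Lemma expect_indic A : measurable A -> expect (\1_A : T -> R) = pr A.
Proof. by move=> mA; rewrite /expect /Rintegral integral_indic// setIT. Qed.

Lemma expect_sum (I : Type) (s : seq I) (G : I -> T -> R) :
  (forall i, bmeas (G i)) ->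
  expect (fun x => \sum_(i <- s) G i x) = \sum_(i <- s) expect (G i).
Proof.
move=> mG; elim: s => [|i s IH].
  by under [X in expect X]funext => x do rewrite big_nil; rewrite expect_cst big_nil.
under [X in expect X]funext => x do rewrite big_cons.
by rewrite expectD ?IH ?big_cons//; exact: bmeas_sum.
Qed.

Lemma pr_cover_le (I : eqType) (s : seq I) (F : I -> set T) A :
  measurable A -> (forall i, measurable (F i)) ->
  (forall x, A x -> exists2 i, i \in s & F i x) ->
  pr A <= \sum_(i <- s) pr (F i).
Proof.
move=> mA mF cov; have bF i : bmeas (\1_(F i) : T -> R) by exact: bmeas_indic.
rewrite -expect_indic//; under eq_bigr do rewrite -expect_indic//.
rewrite -expect_sum//; apply: le_expect; [exact: bmeas_indic|exact: bmeas_sum|].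
move=> x; rewrite {1}indicE; case: (boolP (x \in A)); last first.
  by move=> _; exact: sumr_ge0.
rewrite inE => /cov[i si Fi]; rewrite (big_rem _ si)/= indicE mem_set// lerDl.
exact: sumr_ge0.
Qed.

End RealProbability.

(** * Invariance, ergodicity and a one-sided ergodic theorem *)

Section Invariance.
Context (d : measure_display) (T : measurableType d) (R : realType).
Variables (mu : probability T R) (f : T -> T).
Hypotheses (mf : measurable_fun setT f) (inv : invariant_measure mu f).
Implicit Types (A : set T) (g : T -> R).

Lemma measurable_iter n : measurable_fun setT (iter n f).
Proof.
elim: n => [|n IH]; first exact: measurable_id.
rewrite (_ : iter n.+1 f = f \o iter n f); last exact/funext.
exact: measurableT_comp.
Qed.

Lemma measurable_preiter n A : measurable A -> measurable (iter n f @^-1` A).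
Proof. by move=> mA; rewrite -[X in measurable X]setTI; exact: measurable_iter. Qed.

Lemma preiterS n A : iter n.+1 f @^-1` A = f @^-1` (iter n f @^-1` A).
Proof. by apply/funext => x; rewrite /preimage/= -iterSr. Qed.

Lemma invariant_iter n A : measurable A -> mu (iter n f @^-1` A) = mu A.
Proof.
move=> mA; elim: n => [//|n IH].
by rewrite preiterS inv ?IH//; exact: measurable_preiter.
Qed.

Lemma bmeas_comp g : bmeas g -> bmeas (g \o f).
Proof.
move=> [mg [M gM]]; split; first exact: measurableT_comp.
by exists M => x; exact: gM.
Qed.

Lemma bmeas_iter n g : bmeas g -> bmeas (fun x => g (iter n f x)).
Proof.
move=> bg; elim: n => [//|n IH].
rewrite (_ : (fun _ => _) = (fun x => g (iter n f x)) \o f); first exact: bmeas_comp.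
by apply/funext => x; rewrite /= -iterSr.
Qed.

Lemma expect_comp g : bmeas g -> expect mu (g \o f) = expect mu g.
Proof.
move=> bg; rewrite /expect /Rintegral; congr fine.
have [mg _] := bg.
have mgE : measurable_fun setT (EFin \o g) by exact/measurable_EFinP.
have ig := bmeas_integrable mu (bmeas_comp bg).
transitivity (\int[pushforward mu f]_x (g x)%:E)%E.
  by rewrite (integral_pushforward mf mgE)// preimage_setT.
by apply: eq_measure_integral => A mA _; exact: inv.
Qed.

Lemma expect_iter n g : bmeas g -> expect mu (fun x => g (iter n f x)) = expect mu g.
Proof.
move=> bg; elim: n => [//|n <-].
rewrite -(expect_comp (bmeas_iter n bg)); congr (expect mu _).
by apply/funext => x; rewrite /= -iterSr.
Qed.

Lemma expect_birkhoff n g : bmeas g ->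
  expect mu (fun x => \sum_(j < n) g (iter j f x)) = n%:R * expect mu g.
Proof.
move=> bg; rewrite expect_sum; last by move=> j; exact: bmeas_iter.
rewrite (eq_bigr (fun=> expect mu g)) => [|j _]; last exact: expect_iter.
by rewrite sumr_const card_ord mulr_natl.
Qed.

Lemma bmeas_birkhoff n g : bmeas g ->
  bmeas (fun x => \sum_(j < n) g (iter j f x)).
Proof. by move=> bg; apply: bmeas_sum => j; exact: bmeas_iter. Qed.

Hypothesis erg : ergodic_measure mu f.

(** The preimages of [A] increase to a strictly invariant set, which has the
    same measure as [A] because they all have it. *)
Lemma ergodic_subinvariant A : measurable A -> A `<=` f @^-1` A ->
  mu A = 0%E \/ mu A = 1%E.
Proof.
move=> mA AfA; pose F n := iter n f @^-1` A.
have mF n : measurable (F n) by exact: measurable_preiter.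
have FS n : F n `<=` F n.+1 by move=> x Fx; exact: AfA.
have mU : measurable (\bigcup_n F n) by exact: bigcupT_measurable.
have cv : (mu \o F) n @[n --> \oo] --> mu (\bigcup_n F n).
  apply: nondecreasing_cvg_mu => //.
  by apply/nondecreasing_seqP => n; apply/subsetPset; exact: FS.
have muU : mu (\bigcup_n F n) = mu A.
  rewrite -(cvg_lim _ cv)//.
  rewrite (_ : mu \o F = fun=> mu A) ?lim_cst//.
  by apply/funext => n /=; rewrite invariant_iter.
rewrite -muU; apply: erg => //.
apply/seteqP; split => x /=.
  by move=> [n _ Fn]; exists n.+1 => //; rewrite /F preiterS.
by move=> [n _ /FS Fn]; exists n => //; move: Fn; rewrite /F preiterS.
Qed.

Section MaximalErgodic.
Variable g : T -> R.
Hypothesis bg : bmeas g.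

(* the maximum of the ergodic sums of g of lengths 1, ..., n + 1 *)
Let maxsum := fix maxsum n x : R :=
  if n is n'.+1 then g x + Num.max 0 (maxsum n' (f x)) else g x.

Let bmeas_maxsum n : bmeas (maxsum n).
Proof.
elim: n => [//|n IH] /=; apply: bmeasD => //.
by apply: bmeas_max; [exact: bmeas_cst|exact: (bmeas_comp IH)].
Qed.

Let maxsum_incr n x : maxsum n x <= maxsum n.+1 x.
Proof.
elim: n x => [|n IH] x /=; first by rewrite lerDl le_max lexx.
by rewrite lerD2l ge_max !le_max lexx/= (IH (f x)) orbT.
Qed.

Let birkhoff_le_maxsum n x : \sum_(j < n.+1) g (iter j f x) <= maxsum n x.
Proof.
elim: n x => [|n IH] x; first by rewrite big_ord1.
rewrite big_ord_recl /= lerD2l le_max; apply/orP; right.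
by under eq_bigr do rewrite -iterS iterSr; exact: IH.
Qed.

Let unbounded := \bigcap_(k : nat) \bigcup_n [set x | k%:R < maxsum n x].

Let measurable_gt (h : T -> R) (r : R) : measurable_fun setT h ->
  measurable [set x | r < h x].
Proof.
move=> mh; rewrite (_ : [set _ | _] = h @^-1` `]r, +oo[%classic); last first.
  by apply/seteqP; split => x /=; rewrite in_itv/= andbT.
by rewrite -[X in measurable X]setTI; apply: mh => //; exact: measurable_itv.
Qed.

Let measurable_unbounded : measurable unbounded.
Proof.
apply: bigcapT_measurable => k; apply: bigcupT_measurable => n.
by apply: measurable_gt; have [] := bmeas_maxsum n.
Qed.

Let unbounded_invariant : f @^-1` unbounded = unbounded.
Proof.
have [_ [M gM]] := bg.
have [m Mm] : exists m : nat, M <= m%:R.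
  by exists (Num.truncn M).+1; rewrite ltW// truncnS_gt.
apply/seteqP; split => x H k _.
- have [n _ /= Hn] := H (k + m)%N I; exists n.+1 => //=.
  have : - M <= g x by have := gM x; rewrite ler_norml => /andP[].
  rewrite natrD in Hn; have : maxsum n (f x) <= Num.max 0 (maxsum n (f x)).
    by rewrite le_max lexx orbT.
  by move: Hn Mm; lra.
- have [n _ /= Hn] := H (k + m)%N I; exists n => //=.
  have {}Hn := lt_le_trans Hn (maxsum_incr n x).
  move: Hn => /=; have : g x <= M by have := gM x; rewrite ler_norml => /andP[].
  have k0 : 0 <= k%:R :> R by [].
  rewrite natrD; case: (leP 0 (maxsum n (f x))) => _; move: k0 Mm; lra.
Qed.

Hypothesis g_neg : expect mu g < 0.

(* [maxsum n.+1 - maxsum n \o f] has a nonnegative mean by invariance, and it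
   equals g wherever [maxsum n \o f > 0]: if maxsum were a.e. unbounded, its
   mean would tend to the mean of g. *)
Let unbounded_null : mu unbounded = 0%E.
Proof.
have [//|U1] := erg measurable_unbounded unbounded_invariant.
exfalso; have [_ [M0 gM0]] := bg.
pose M := Num.max M0 1; have M1 : 1 <= M by rewrite le_max lexx orbT.
have gM x : `|g x| <= M by rewrite le_max gM0.
pose B n := [set x | 0 < maxsum n x].
have mB n : measurable (B n) by apply: measurable_gt; have [] := bmeas_maxsum n.
have [n Bn] : exists n, pr mu (~` B n) < - expect mu g / M.
  apply: pr_bigcup_incr => //.
  - by move=> n x /= /lt_le_trans; apply; exact: maxsum_incr.
  - have : mu (~` unbounded) = 0%E.
      by rewrite probability_setC// -[X in (1 - X)%E]/(mu _) U1 subee.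
    apply: subset_measure0.
    + by apply: measurableC; exact: bigcupT_measurable.
    + exact: measurableC.
    + by apply: subsetC => x /(_ 0%N I) [n _ /= xn]; exists n.
  - by rewrite divr_gt0 ?oppr_gt0//; lra.
have h1 : expect mu (maxsum n.+1) <=
    expect mu (fun x => g x + (maxsum n (f x) + M * \1_(~` (f @^-1` B n)) x)).
  apply: le_expect => //.
    apply: bmeasD => //; apply: bmeasD; first exact: (bmeas_comp (bmeas_maxsum n)).
    apply: bmeasZ; apply: bmeas_indic; apply: measurableC.
    exact: (measurable_preiter 1).
  move=> x /=; rewrite lerD2l indicE.
  have gle : g (f x) <= maxsum n (f x).
    by elim: (n) => [//|k IH]; exact: le_trans IH (maxsum_incr k (f x)).
  have := gM (f x); rewrite ler_norml => /andP[gm _].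
  rewrite /B in_setC; case: (boolP (x \in _)); rewrite ?inE/= ?notin_setE/= => H.
    by rewrite mulr0 addr0 ge_max lexx (ltW H).
  have -> : Num.max 0 (maxsum n (f x)) = 0.
    by apply/max_idPl; rewrite leNgt; apply/negP.
  by rewrite mulr1; lra.
have mfB : measurable (f @^-1` B n) by exact: (measurable_preiter 1).
rewrite expectD// in h1; last first.
  apply: bmeasD; first exact: (bmeas_comp (bmeas_maxsum n)).
  by apply: bmeasZ; apply: bmeas_indic; exact: measurableC.
rewrite expectD in h1; last 2 first.
  exact: (bmeas_comp (bmeas_maxsum n)).
  by apply: bmeasZ; apply: bmeas_indic; exact: measurableC.
rewrite expectZ ?expect_indic in h1; last 2 first.
  exact: measurableC.
  by apply: bmeas_indic; exact: measurableC.
have e1 : expect mu (fun x => maxsum n (f x)) = expect mu (maxsum n).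
  exact: (expect_comp (bmeas_maxsum n)).
rewrite e1 in h1.
have h2 : expect mu (maxsum n) <= expect mu (maxsum n.+1) by apply: le_expect.
have e2 : pr mu (~` (f @^-1` B n)) = pr mu (~` B n).
  by rewrite !pr_setC// /pr inv.
rewrite e2 in h1.
have : M * pr mu (~` B n) < - expect mu g.
  by rewrite mulrC -ltr_pdivlMr//; lra.
move: h1 h2; lra.
Qed.

(** The half of the pointwise ergodic theorem that is used: applied to [g - s],
    it bounds the ergodic sums of [g] by [s n + C] for every [s] above the
    mean of [g]. *)
Lemma birkhoff_bounded :
  {ae mu, forall x, exists C : R, forall n, \sum_(j < n) g (iter j f x) <= C}.
Proof.
exists unbounded; split => // x /= H k _; apply: contrapT => nU; apply: H.
exists k%:R => -[|n]; first by rewrite big_ord0.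
apply: le_trans (birkhoff_le_maxsum n x) _; rewrite leNgt; apply/negP => kn.
by apply: nU; exists n.
Qed.

End MaximalErgodic.

End Invariance.

(** * Itineraries and block entropies *)

Section Itinerary.
Variables (T : Type) (f : T -> T) (A : Type) (xi : T -> A).

Definition itin n x : seq A := map xi (traject f x n).

Lemma size_itin n x : size (itin n x) = n.
Proof. by rewrite size_map size_traject. Qed.

Lemma itinS n x : itin n.+1 x = xi x :: itin n (f x).
Proof. by []. Qed.

Lemma itin_cat m n x : itin (m + n) x = itin m x ++ itin n (iter m f x).
Proof.
by elim: m x => [//|m IH] x; rewrite addSn !itinS IH cat_cons iterSr.
Qed.

Lemma take_itin k n x : (k <= n)%N -> take k (itin n x) = itin k x.
Proof. by move=> kn; rewrite -(subnKC kn) itin_cat take_size_cat// size_itin. Qed.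

Lemma drop_itin k n x : (k <= n)%N -> drop k (itin n x) = itin (n - k) (iter k f x).
Proof. by move=> kn; rewrite -{1}(subnKC kn) itin_cat drop_size_cat// size_itin. Qed.

Lemma eq_itinP n x y :
  itin n x = itin n y <-> forall j, (j < n)%N -> xi (iter j f x) = xi (iter j f y).
Proof.
elim: n x y => [//|n IH] x y; rewrite !itinS; split.
  by move=> [xy /IH H] [//|j] jn; rewrite !iterSr; exact: H.
move=> H; have := H 0%N isT; rewrite /= => ->; congr cons; apply/IH => j jn.
by have := H j.+1 jn; rewrite !iterSr.
Qed.

End Itinerary.

Section Observable.
Context (d : measure_display) (T : measurableType d) (R : realType).
Variables (mu : probability T R) (f : T -> T).
Hypotheses (mf : measurable_fun setT f) (inv : invariant_measure mu f).
Variables (A : finType) (xi : T -> A).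
Hypothesis mxi : forall a, measurable (xi @^-1` [set a]).

Local Notation itin := (itin f xi).

Definition cylinder w := [set x | itin (size w) x = w].

Definition cyl_pr w : R := pr mu (cylinder w).

Local Notation p := cyl_pr.

Lemma cylinder_cons a w :
  cylinder (a :: w) = (xi @^-1` [set a]) `&` (f @^-1` cylinder w).
Proof.
apply/seteqP; split => x; rewrite /cylinder/= itinS; first by move=> [-> ->].
by move=> [-> ->].
Qed.

Lemma cylinder_nil : cylinder [::] = setT.
Proof. exact/seteqP. Qed.

Lemma measurable_cylinder w : measurable (cylinder w).
Proof.
elim: w => [|a w IH]; first by rewrite cylinder_nil.
by rewrite cylinder_cons; apply: measurableI => //; exact: (measurable_preiter mf 1).
Qed.
#[local] Hint Resolve measurable_cylinder : core.

Lemma itin_decomp (phi : seq A -> R) n x :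
  phi (itin n x) = \sum_(w <- words A n) phi w * \1_(cylinder w) x.
Proof.
have h : itin n x \in words A n by rewrite mem_words size_itin.
rewrite (bigD1_seq (itin n x))//= ?uniq_words// indicE mem_set; last first.
  by rewrite /cylinder/= size_itin.
rewrite mulr1 big_seq_cond big1 ?addr0// => w /andP[].
rewrite mem_words => /eqP sw /eqP wx.
by rewrite indicE memNset ?mulr0// /cylinder/= sw => /esym.
Qed.

Lemma bmeas_itin (phi : seq A -> R) n : bmeas (fun x => phi (itin n x)).
Proof.
under [X in bmeas X]funext => x do rewrite itin_decomp.
by apply: bmeas_sum => w; apply: bmeasZ; exact: bmeas_indic.
Qed.

Lemma expect_itin (phi : seq A -> R) n :
  expect mu (fun x => phi (itin n x)) = \sum_(w <- words A n) p w * phi w.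
Proof.
under [X in expect mu X]funext => x do rewrite itin_decomp.
rewrite expect_sum; last by move=> w; apply: bmeasZ; exact: bmeas_indic.
apply: eq_bigr => w _; rewrite expectZ ?expect_indic// 1?mulrC//.
exact: bmeas_indic.
Qed.

Lemma measurable_itin (P : set (seq A)) n : measurable [set x | P (itin n x)].
Proof.
rewrite (_ : [set _ | _] = \bigcup_(w in [set w | P w /\ w \in words A n]) cylinder w).
  apply: fin_bigcup_measurable => //.
  apply: (@sub_finite_set _ _ [set` words A n]); first by move=> w [].
  exact: finite_seq.
apply/seteqP; split => x /=.
  by move=> Px; exists (itin n x) => /=; rewrite /cylinder/= ?mem_words size_itin.
by move=> [w /= [Pw]]; rewrite mem_words => /eqP <- ->.
Qed.

Lemma pr_itin (P : pred (seq A)) n :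
  pr mu [set x | P (itin n x)] = \sum_(w <- words A n) p w * (P w)%:R.
Proof.
rewrite -expect_itin -expect_indic; last exact: (measurable_itin (fun w => P w)).
congr expect; apply/funext => x; rewrite indicE; congr (_%:R).
by case: (boolP (P (itin n x))) => Px; [rewrite mem_set|rewrite memNset//; exact/negP].
Qed.

Lemma cyl_pr_ge0 w : 0 <= p w. Proof. exact: pr_ge0. Qed.

Lemma cyl_pr_nil : p [::] = 1.
Proof. by rewrite /p cylinder_nil pr_setT. Qed.

Lemma cyl_pr_sum n : \sum_(w <- words A n) p w = 1.
Proof.
have := expect_itin (fun=> 1) n; rewrite expect_cst => ->.
by apply: eq_bigr => w _; rewrite mulr1.
Qed.

Lemma card_alphabet_gt0 : (0 < #|A|)%N.
Proof.
rewrite lt0n; apply/eqP => /card0_eq A0; have := cyl_pr_sum 1.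
rewrite sum_wordsS big1 => [/esym/eqP|a _]; first by rewrite oner_eq0.
by have := A0 a; rewrite inE.
Qed.

Lemma cyl_pr_cons w : \sum_(a : A) p (a :: w) = p w.
Proof.
rewrite /p /pr -(inv (measurable_cylinder w)) -/(pr mu _).
rewrite -expect_indic; last exact: (measurable_preiter mf 1).
under eq_bigr do rewrite -/(pr mu _) -expect_indic//.
rewrite -expect_sum; last by move=> a; exact: bmeas_indic.
congr expect; apply/funext => x; rewrite (bigD1 (xi x))//=.
rewrite cylinder_cons !indicE in_setI mem_set//= big1 ?addr0// => a /eqP ax.
by rewrite indicE cylinder_cons in_setI memNset//= => /esym.
Qed.

Lemma cyl_pr_behead a w : p (a :: w) <= p w.
Proof.
rewrite -(cyl_pr_cons w) (bigD1 a)//= lerDl sumr_ge0// => b _; exact: cyl_pr_ge0.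
Qed.

Lemma cyl_pr_take k w : p w <= p (take k w).
Proof.
apply: le_pr => // x; rewrite /cylinder/= => xw.
have [kw|/ltnW wk] := leqP k (size w); last by rewrite take_oversize.
by rewrite size_takel// -[in RHS]xw take_itin.
Qed.

Definition block_entropy n : R := - \sum_(w <- words A n) p w * ln (p w).

Lemma block_entropy_le (q : seq A -> R) n : (forall w, 0 <= q w) ->
  (forall w, 0 < p w -> 0 < q w) -> \sum_(w <- words A n) q w <= 1 ->
  block_entropy n <= expect mu (fun x => - ln (q (itin n x))).
Proof.
move=> q0 pq q1; rewrite (expect_itin (fun w => - ln (q w))) /block_entropy.
by apply: gibbs => // [w _|w _|]; rewrite ?cyl_pr_ge0 ?cyl_pr_sum//; exact: pq.
Qed.

End Observable.

(** * Entropy rate, typical words *)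

Section EntropyRate.
Context (d : measure_display) (T : measurableType d) (R : realType).
Variables (mu : probability T R) (f : T -> T).
Hypotheses (mf : measurable_fun setT f) (inv : invariant_measure mu f).
Variables (A : finType) (xi : T -> A).
Hypothesis mxi : forall a, measurable (xi @^-1` [set a]).

Local Notation itin := (itin f xi).
Local Notation p := (cyl_pr mu f xi).
Local Notation H := (block_entropy mu f xi).

Section Markov.
Variable k : nat.

(** The law on words of the Markov approximation of memory [k], built from right
    to left: invariance of the measure is what makes the weights of [a :: w],
    summed over [a], add up to that of [w]. *)
Fixpoint markov (w : seq A) : R :=
  if w is a :: v then markov v * (p (a :: take k v) / p (take k v)) else 1.

Lemma markov_ge0 w : 0 <= markov w.
Proof.
by elim: w => [|a w IH] //=; rewrite mulr_ge0// divr_ge0// cyl_pr_ge0.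
Qed.

Lemma markov_sum n : \sum_(w <- words A n) markov w <= 1.
Proof.
elim: n => [|n IH]; first by rewrite sum_words0.
rewrite sum_wordsS exchange_big /=; apply: le_trans IH.
apply: ler_sum => w _; rewrite -mulr_sumr -mulr_suml cyl_pr_cons//.
rewrite ler_piMr ?markov_ge0//; case: (eqVneq (p (take k w)) 0) => [->|p0].
  by rewrite mul0r.
by rewrite divff.
Qed.

Lemma markov_gt0 w : 0 < p w -> 0 < markov w.
Proof.
elim: w => [|a w IH] //= paw; have pw := lt_le_trans paw (cyl_pr_behead mf inv mxi a w).
rewrite mulr_gt0 ?IH// divr_gt0//; last exact: lt_le_trans pw (cyl_pr_take mu mf mxi k w).
exact: lt_le_trans paw (cyl_pr_take mu mf mxi k.+1 (a :: w)).
Qed.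

Lemma markov_short w : (size w <= k)%N -> markov w = p w.
Proof.
elim: w => [|a w IH] /= sw; first by rewrite cyl_pr_nil.
rewrite IH ?(ltnW sw)// take_oversize ?(ltnW sw)//.
have [pw|pw] := eqVneq (p w) 0; last by rewrite mulrCA divff// mulr1.
rewrite pw mul0r; apply/eqP; rewrite eq_le cyl_pr_ge0 /= -pw.
exact: cyl_pr_behead.
Qed.

Let info (w : seq A) : R := - ln (p w / p (behead w)).

(** Conditional information of the first letter given the next [k] ones. *)
Definition markov_info x : R := info (itin k.+1 x).

Lemma bmeas_markov_info : bmeas markov_info.
Proof. exact: bmeas_itin. Qed.

Lemma expect_markov_info : expect mu markov_info = H k.+1 - H k.
Proof.
rewrite /markov_info expect_itin// /block_entropy opprK addrC.
have -> : \sum_(w <- words A k) p w * ln (p w) =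
    \sum_(w <- words A k.+1) p w * ln (p (behead w)).
  rewrite sum_wordsS exchange_big /=; apply: eq_bigr => w _.
  by rewrite -mulr_suml cyl_pr_cons.
rewrite -sumrB; apply: eq_sum_words => -[|a w]// _; rewrite /info.
have := cyl_pr_ge0 mu f xi (a :: w); rewrite le_eqVlt => /predU1P[<-|paw].
  by rewrite !mul0r subrr.
rewrite ln_div ?posrE//; first by ring.
exact: lt_le_trans paw (cyl_pr_behead mf inv mxi a w).
Qed.

Lemma markov_info_ge0 x : 0 <= markov_info x.
Proof.
rewrite /markov_info itinS /info/= oppr_ge0.
have uv : p (xi x :: itin k (f x)) <= p (itin k (f x)) by exact: cyl_pr_behead.
have := cyl_pr_ge0 mu f xi (itin k (f x)); rewrite le_eqVlt => /predU1P[<-|pv].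
  by rewrite invr0 mulr0 ln0.
by rewrite ln_le0// ler_pdivrMr// mul1r.
Qed.

(** The constant pays for the first [k] letters read, coded by their own law. *)
Lemma markov_log : exists C : R, 0 <= C /\ forall m x,
  - ln (markov (itin (m + k) x)) <= C + \sum_(j < m) markov_info (iter j f x).
Proof.
exists (\sum_(w <- words A k) `|ln (p w)|); split; first exact: sumr_ge0.
elim=> [|m IH] x.
  rewrite big_ord0 addr0 add0n markov_short ?size_itin//.
  have iw : itin k x \in words A k by rewrite mem_words size_itin.
  rewrite (big_rem _ iw)/= ler_wpDr ?sumr_ge0//.
  by rewrite -normrN ler_norm.
rewrite big_ord_recl addSn itinS /=.
under [X in _ + (_ + X)]eq_bigr do rewrite -iterS iterSr.
have {}IH := IH (f x); have i0 := markov_info_ge0 x.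
have m0 := markov_ge0 (itin (m + k) (f x)).
rewrite take_itin ?leq_addl//.
have r0 : 0 <= p (xi x :: itin k (f x)) / p (itin k (f x)).
  by rewrite divr_ge0// cyl_pr_ge0.
have S0 : 0 <= \sum_(w <- words A k) `|ln (p w)| +
    \sum_(j < m) markov_info (iter j f (f x)).
  by rewrite addr_ge0// sumr_ge0// => j _; exact: markov_info_ge0.
have S1 : 0 <= \sum_(w <- words A k) `|ln (p w)| + (markov_info x +
    \sum_(j < m) markov_info (iter j f (f x))) by lra.
move: m0; rewrite le_eqVlt => /predU1P[<-|m0]; first by rewrite mul0r ln0// oppr0.
move: r0; rewrite le_eqVlt => /predU1P[<-|r0]; first by rewrite mulr0 ln0// oppr0.
rewrite lnM ?posrE//; move: IH.
have -> : markov_info x = - ln (p (xi x :: itin k (f x)) / p (itin k (f x))) by [].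
lra.
Qed.

Lemma block_entropy_markov : exists C : R,
  forall m, H (m + k)%N <= C + m%:R * (H k.+1 - H k).
Proof.
have [C [_ HC]] := markov_log; exists C => m.
apply: le_trans (block_entropy_le _ _ markov_ge0 markov_gt0 (markov_sum _)) _ => //.
rewrite -expect_markov_info -(expect_birkhoff mf inv m bmeas_markov_info).
rewrite -[C in leRHS](expect_cst mu) -expectD; last 2 first.
- exact: bmeas_cst.
- exact: (bmeas_birkhoff mf m bmeas_markov_info).
apply: le_expect => //.
  exact: (@bmeas_itin _ _ _ _ mf _ _ mxi (fun w => - ln (markov w))).
apply: bmeasD; first exact: bmeas_cst.
exact: (bmeas_birkhoff mf m bmeas_markov_info).
Qed.

End Markov.

Lemma block_entropy0 : H 0%N = 0.
Proof. by rewrite /block_entropy sum_words0 cyl_pr_nil ln1 mulr0 oppr0. Qed.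

Lemma block_entropy_incr k : 0 <= H k.+1 - H k.
Proof.
rewrite -expect_markov_info -[leLHS](expect_cst mu).
apply: le_expect; [exact: bmeas_cst|exact: bmeas_markov_info|].
exact: markov_info_ge0.
Qed.

(** The entropy rate as the infimum of the increments of the block entropies:
    [H n] is the sum of the first increments, whence [n * rate <= H n], and the
    Markov code of memory [k] bounds [H n / n] asymptotically by the [k]-th
    increment. So [H n / n] converges to it, which gives a meaning to the limit
    that defines the entropy of a partition. *)
Definition rate : R := inf [set H k.+1 - H k | k in setT].

Let rate_lb : has_lbound [set H k.+1 - H k | k in setT].
Proof. by exists 0 => _ [k _ <-]; exact: block_entropy_incr. Qed.

Lemma rate_le k : rate <= H k.+1 - H k.
Proof. by apply: ge_inf => //; exists k. Qed.

Lemma rate_ge0 : 0 <= rate.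
Proof.
apply: lb_le_inf; first by exists (H 1%N - H 0%N); exists 0%N.
by move=> _ [k _ <-]; exact: block_entropy_incr.
Qed.

Lemma rate_approx s : rate < s -> exists k, H k.+1 - H k < s.
Proof.
move=> rs; have hi : has_inf [set H k.+1 - H k | k in setT].
  by split => //; exists (H 1%N - H 0%N); exists 0%N.
have s0 : 0 < s - rate by rewrite subr_gt0.
have [_ [k _ <-] hk] := inf_adherent s0 hi.
by exists k; move: hk; rewrite -/rate; lra.
Qed.

Lemma rate_block n : n%:R * rate <= H n.
Proof.
elim: n => [|n IH]; first by rewrite mul0r block_entropy0.
by have := rate_le n; rewrite -natr1 mulrDl mul1r; move: IH; lra.
Qed.

Lemma rate_cvg : H n / n%:R @[n --> \oo] --> rate.
Proof.
apply/cvgrPdist_lt => e e0.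
have [k hk] := @rate_approx (rate + e / 2) ltac:(lra).
have [C HC] := block_entropy_markov k.
pose N := (Num.truncn (2 * `|C| / e)).+1.
exists (N + k.+1)%N => // n /= nN.
have kn : (k <= n)%N by rewrite (leq_trans _ nN)// (leq_trans _ (leq_addl _ _)).
have n0 : 0 < n%:R :> R.
  by rewrite ltr0n (leq_trans _ nN)// addnS.
have h1 := rate_block n; have := HC (n - k)%N; rewrite subnK// => h2.
have i0 := block_entropy_incr k.
have h3 : (n - k)%:R * (H k.+1 - H k) <= n%:R * (rate + e / 2).
  apply: le_trans (_ : n%:R * (H k.+1 - H k) <= _).
    by rewrite ler_wpM2r// ler_nat leq_subr.
  by rewrite ler_wpM2l ?ltW.
have h4 : C < n%:R * (e / 2).
  have : 2 * `|C| / e < n%:R.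
    apply: lt_le_trans (truncnS_gt _) _; rewrite ler_nat.
    by rewrite (leq_trans _ nN)// leq_addr.
  by rewrite ltr_pdivrMr//; have := ler_norm C; lra.
rewrite distrC ltr_norml; apply/andP; split.
  by rewrite ltrBrDr ltr_pdivlMr//; nra.
by rewrite ltrBlDr ltr_pdivrMr//; nra.
Qed.

(** Upper half of the Shannon-McMillan-Breiman theorem, in counting form. The
    typical words of length [n] are those of Markov weight at least [exp (- s n)],
    so there are at most [exp (s n)] of them. The logarithm of the Markov weight
    of an itinerary is an ergodic sum of mean less than [s], so almost every
    itinerary is eventually typical. *)
Lemma typical_words (erg : ergodic_measure mu f) s : rate < s ->
  exists Ty : pred (seq A),
    (forall n, (count Ty (words A n))%:R <= expR (s * n%:R)) /\
    {ae mu, forall x, exists n0, forall n, (n0 <= n)%N -> Ty (itin n x)}.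
Proof.
move=> rs; have [k hk] := rate_approx rs.
pose Ty w := expR (- (s * (size w)%:R)) <= markov k w.
exists Ty; split.
  move=> n; rewrite -sum_pred_words.
  apply: le_trans (_ : expR (s * n%:R) * \sum_(w <- words A n) markov k w <= _).
    rewrite mulr_sumr; apply: ler_sum_words => w sw; rewrite /Ty sw.
    case: (boolP (_ <= markov k w)) => [h|_] /=; last by rewrite mulr_ge0 ?expR_ge0 ?markov_ge0.
    by apply: le_trans (ler_wpM2l (expR_ge0 _) h); rewrite -expRD subrr expR0.
  by rewrite ler_piMr ?expR_ge0 ?markov_sum.
pose s' := ((H k.+1 - H k) + s) / 2.
have bg : bmeas (fun x => markov_info k x - s').
  by apply: bmeasD; [exact: bmeas_markov_info|exact: bmeas_cst].
have Eg : expect mu (fun x => markov_info k x - s') < 0.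
  rewrite expectD; [|exact: bmeas_markov_info|exact: bmeas_cst].
  by rewrite expect_cst expect_markov_info /s'; lra.
have h1 := birkhoff_bounded mf inv erg bg Eg.
have h2 : {ae mu, forall x, forall n, 0 < p (itin n x)}.
  apply: ae_foralln => n; exists [set x | ~~ (0 < p (itin n x))]; split.
  - exact: (measurable_itin mf mxi (fun w => ~~ (0 < p w))).
  - rewrite -[LHS]/(mu _) prE; last exact: (measurable_itin mf mxi (fun w => ~~ (0 < p w))).
    rewrite (pr_itin mu mf mxi (fun w => ~~ (0 < p w))) big1// => w _.
    have [->|pw0] := eqVneq (p w) 0; first by rewrite mul0r.
    by rewrite lt_neqAle eq_sym pw0 cyl_pr_ge0 mulr0.
  - by move=> x /= /negP.
have [C [C0 HC]] := markov_log k.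
move: h1 h2; apply: filterS2 => x [C1 hC1] px.
pose N := (Num.truncn ((C + `|C1|  + `|s'| * k%:R + `|s| * k%:R) / (s - s'))).+1.
exists (N + k)%N => n nN; rewrite /Ty size_itin.
have mx := markov_gt0 k (px n).
rewrite -[leRHS]lnK ?posrE// ler_expR lerNl.
have kn : (k <= n)%N by rewrite (leq_trans _ nN)// leq_addl.
rewrite -(subnK kn); apply: le_trans (HC _ _) _.
have := hC1 (n - k)%N; rewrite sumrB sumr_const card_ord => h.
have h3 : (C + `|C1| + `|s'| * k%:R + `|s| * k%:R) < (n - k)%:R * (s - s').
  rewrite -ltr_pdivrMr; last by rewrite /s'; lra.
  apply: lt_le_trans (truncnS_gt _) _; rewrite ler_nat.
  by rewrite leq_subRL// addnC.
have h4 : 0 <= `|s'| * k%:R by [].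
have h5 : - (s * k%:R) <= `|s| * k%:R.
  by rewrite -mulNr ler_wpM2r// -normrN ler_norm.
have h6 := ler_norm C1.
rewrite natrD; move: h; rewrite -mulr_natl; nra.
Qed.

(** The block code reads the itinerary greedily: a block where the current point
    is in [G], a single letter elsewhere. The expected number of letters read
    singly in [n] steps is at most [n] times the probability of [~` G], and the
    window [M <= n < M + M'] keeps the last, incomplete block bounded. *)
Lemma rate_le_block_code (D : seq A -> seq A -> bool) (G : set T)
    (c eps : R) (M M' L : nat) :
  (0 < M)%N -> measurable G -> 0 <= c + eps ->
  (forall n v, (M <= n < M + M')%N ->
     \sum_(u <- words A n) (D u v)%:R <= expR (c * n%:R)) ->
  \sum_(n <- iota M M') expR (- (eps * n%:R)) <= 2^-1 ->
  (forall x, G x -> exists2 n, (M <= n < M + M')%N &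
     forall l, (L <= l)%N -> D (itin n x) (itin l (iter n f x))) ->
  rate <= c + eps + pr mu (~` G) * ln (2 * #|A|%:R).
Proof.
move=> M0 mG g0 Dc Ml hG; set g := c + eps in g0 *.
set b := ln (2 * #|A|%:R).
have A0 : (0 < #|A|)%N by exact: (card_alphabet_gt0 mu mf mxi).
have A1 : 1 <= #|A|%:R :> R by rewrite ler1n.
have b0 : 0 <= b by rewrite /b ln_ge0//; lra.
have betaE : (2 * #|A|%:R)^-1 = expR (- b) :> R.
  by rewrite expRN /b lnK// posrE; lra.
pose q := block_code D g M M'.
have q0 w : 0 < q w by exact: block_code_gt0.
(* words too short to contain a block and its future are read letter by letter *)
pose B := (M + M' + L)%N.
have mGc : measurable (~` G) by exact: measurableC.
have key0 n x : expR (- (b * n%:R)) <= q (itin n x).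
  elim: n x => [|n IH] x; first by rewrite /q /block_code mulr0 oppr0 expR0.
  rewrite itinS; apply: le_trans (block_code_letter _ _ _ _ _ _) => //.
  rewrite betaE; apply: le_trans (ler_wpM2l (expR_ge0 _) (IH (f x))).
  by rewrite -expRD ler_expR -natr1; lra.
have key n x : expR (- (g * n%:R + b * (B%:R + \sum_(j < n) \1_(~` G) (iter j f x))))
    <= q (itin n x).
  have sum_ge0 m y : 0 <= \sum_(j < m) \1_(~` G) (iter j f y) :> R by exact: sumr_ge0.
  have shift a m y : \sum_(j < m) \1_(~` G) (iter j f (iter a f y)) <=
      \sum_(j < a + m) \1_(~` G) (iter j f y) :> R.
    rewrite big_split_ord /=.
    under [X in _ <= _ + X]eq_bigr do rewrite addnC iterD.
    by rewrite lerDr; exact: sumr_ge0.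
  elim/ltn_ind: n x => n IH x; have [nB|Bn] := leqP n B.
    apply: le_trans (key0 n x); rewrite ler_expR lerN2.
    have h1 : b * n%:R <= b * (B%:R + \sum_(j < n) \1_(~` G) (iter j f x)).
      by rewrite ler_wpM2l// ler_wpDr// ler_nat.
    by apply: le_trans h1 _; rewrite lerDr mulr_ge0.
  have [xG|xG] := pselect (G x).
    have [l lM HD] := hG x xG.
    have ln : (l <= n)%N.
      rewrite ltnW// (leq_trans _ (ltnW Bn))//; case/andP: lM => _ lM.
      by rewrite (leq_trans lM) ?leq_addr.
    have Lnl : (L <= n - l)%N.
      rewrite leq_subRL//; case/andP: lM => _ lM.
      by rewrite (leq_trans _ (ltnW Bn))// leq_add2r ltnW.
    have nl : (n - l < n)%N.
      by rewrite ltn_subrL; case/andP: lM => /(leq_trans M0) -> _; rewrite (leq_ltn_trans _ Bn).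
    have e : itin n x = itin l x ++ itin (n - l) (iter l f x).
      by rewrite -itin_cat subnKC.
    rewrite e; apply: le_trans (block_code_block _ _ _ _) => //; last 2 first.
    - by rewrite size_itin.
    - exact: HD.
    rewrite size_itin; apply: le_trans (ler_wpM2l (expR_ge0 _) (IH _ nl _)).
    rewrite -expRD ler_expR -opprD lerN2 addrA -mulrDr -natrD subnKC// lerD2l.
    by rewrite ler_wpM2l// lerD2l; have := shift l (n - l)%N x; rewrite subnKC.
  case: n IH Bn => [//|n] IH _.
  rewrite itinS; apply: le_trans (block_code_letter _ _ _ _ _ _) => //.
  rewrite betaE; apply: le_trans (ler_wpM2l (expR_ge0 _) (IH n _ (f x))) => //.
  rewrite -expRD ler_expR -opprD lerN2 big_ord_recl /=.
  under [X in _ <= _ + _ * (_ + (_ + X))]eq_bigr do rewrite -iterS iterSr.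
  rewrite indicE mem_set//= -natr1; move: (\sum_(j < n) _) => S.
  by move: g0 b0; lra.
have main n : n%:R * rate <= g * n%:R + b * (B%:R + n%:R * pr mu (~` G)).
  apply: le_trans (rate_block n) _.
  have : H n <= expect mu (fun x => - ln (q (itin n x))).
    apply: block_entropy_le => // [w|]; first exact: ltW.
    exact: (block_code_sum M0 (erefl g) Dc Ml).
  move=> /le_trans; apply.
  have bi : bmeas (\1_(~` G) : T -> R) by exact: bmeas_indic.
  rewrite -(expect_indic mu mGc) -(expect_birkhoff mf inv n bi).
  rewrite -[B%:R in leRHS](expect_cst mu) -expectD; last 2 first.
  - exact: bmeas_cst.
  - exact: bmeas_birkhoff.
  have bB : bmeas (fun x => B%:R + \sum_(j < n) \1_(~` G) (iter j f x) : R).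
    by apply: bmeasD; [exact: bmeas_cst|exact: bmeas_birkhoff].
  rewrite -expectZ// -[g * _ in leRHS](expect_cst mu) -expectD; last 2 first.
  - exact: bmeas_cst.
  - exact: bmeasZ.
  apply: le_expect.
  - exact: (@bmeas_itin _ _ _ _ mf _ _ mxi (fun w => - ln (q w))).
  - by apply: bmeasD; [exact: bmeas_cst|exact: bmeasZ].
  by move=> x; rewrite lerNl -ler_expR lnK ?posrE//; exact: key.
apply/ler_addgt0Pr => e e0.
pose n := (Num.truncn (b * B%:R / e)).+1.
have n0 : 0 < n%:R :> R by rewrite ltr0n.
have : b * B%:R / e < n%:R by exact: truncnS_gt.
rewrite ltr_pdivrMr// => h.
rewrite -(ler_pM2l n0); apply: le_trans (main n) _.
rewrite -/g; move: (n%:R) (pr mu _) (B%:R) h => N P B2 h.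
lra.
Qed.

End EntropyRate.

(** * Returns of itineraries *)

Section Numeric.
Variable R : realType.

Lemma expR_tail_half (eps : R) : 0 < eps -> exists2 M, (0 < M)%N &
  forall M1 M', (M <= M1)%N ->
    \sum_(n <- iota M1 M') expR (- (eps * n%:R)) <= 2^-1.
Proof.
move=> e0; pose th := expR (- eps).
have th0 : 0 < th by exact: expR_gt0.
have th1 : th < 1 by rewrite expR_lt1 oppr_lt0.
have thE n : expR (- (eps * n%:R)) = th ^+ n.
  by rewrite /th -expRM_natr mulNr.
have : geometric (1 - th)^-1 th @ \oo --> (0 : R).
  by apply: cvg_geometric; rewrite ger0_norm// ltW.
move=> /cvgrPdist_lt /(_ 2^-1); rewrite invr_gt0 ltr0n => /(_ isT) [M _ HM].
exists M.+1 => // M1 M' MM1.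
have := HM M1 (ltnW MM1); rewrite /= sub0r normrN ger0_norm; last first.
  by rewrite mulr_ge0 ?invr_ge0 ?subr_ge0 ?exprn_ge0// ltW.
move=> /ltW; apply: le_trans.
have -> : \sum_(n <- iota M1 M') expR (- (eps * n%:R)) =
    \sum_(M1 <= n < M1 + M') th ^+ n.
  by rewrite /index_iota addKn; apply: eq_bigr => n _; rewrite thE.
rewrite geometric_partial_tail geometric_seriesE ?lt_eqF//= [leRHS]mulrC.
rewrite ler_wpM2r ?invr_ge0 ?subr_ge0 ?(ltW th1)// ler_piMr ?exprn_ge0 ?(ltW th0)//.
by rewrite gerBl exprn_ge0// ltW.
Qed.

Lemma expR_absorb (Q a eps : R) : 0 <= Q -> 0 <= a -> 0 < eps ->
  exists M, forall n, (M <= n)%N ->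
    n%:R * (Q + expR (a * n%:R)) <= expR ((a + eps) * n%:R).
Proof.
move=> Q0 a0 e0; exists (Num.truncn (4 * (Q + 1) / eps ^+ 2)).+1 => n nM.
have h : 4 * (Q + 1) < n%:R * eps ^+ 2.
  rewrite -ltr_pdivrMr ?exprn_gt0//; apply: lt_le_trans (truncnS_gt _) _.
  by rewrite ler_nat.
have n0 : 0 < n%:R :> R by rewrite ltr0n (leq_trans _ nM).
have h2 : n%:R * (Q + 1) <= expR (eps * n%:R).
  have -> : expR (eps * n%:R) = expR (eps * n%:R / 2) ^+ 2.
    by rewrite -expRM_natr; congr expR; field.
  have h3 : 0 <= eps * n%:R / 2 by rewrite divr_ge0// mulr_ge0// ltW.
  have h4 : eps * n%:R / 2 <= expR (eps * n%:R / 2).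
    by have := expR_ge1Dx (eps * n%:R / 2); lra.
  apply: (@le_trans _ _ ((eps * n%:R / 2) ^+ 2)); last by rewrite lerXn2r// nnegrE expR_ge0.
  have -> : (eps * n%:R / 2) ^+ 2 = n%:R * (n%:R * eps ^+ 2 / 4) by field.
  by rewrite ler_pM2l// ; lra.
rewrite mulrDl expRD; apply: le_trans (ler_wpM2l (expR_ge0 (a * n%:R)) h2).
have e1 : 1 <= expR (a * n%:R) by rewrite -expR0 ler_expR mulr_ge0.
rewrite mulrCA ler_pM2l//; nra.
Qed.

End Numeric.

Section Returns.
Context (d : measure_display) (T : measurableType d) (R : realType).
Variables (mu : probability T R) (f : T -> T).
Hypotheses (mf : measurable_fun setT f) (inv : invariant_measure mu f).
Hypothesis erg : ergodic_measure mu f.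

Definition no_return (A : set T) K :=
  A `&` [set x | forall m, (1 <= m <= K)%N -> ~ A (iter m f x)].

Lemma measurable_no_return A K : measurable A -> measurable (no_return A K).
Proof.
move=> mA; apply: measurableI => //.
rewrite (_ : [set _ | _] = \bigcap_m
    (if (1 <= m <= K)%N then ~` (iter m f @^-1` A) else setT)).
  apply: bigcapT_measurable => m; case: ifP => // _.
  by apply: measurableC; exact: measurable_preiter.
apply/seteqP; split => x /= H m; first by move=> _; case: ifP => [/H|].
by move=> mK; have := H m I; rewrite mK.
Qed.

(** The preimages of [no_return A K] under the first [K + 1] iterates are
    disjoint and have the same measure. *)
Lemma pr_no_return (A : set T) K : measurable A ->
  pr mu (no_return A K) * K.+1%:R <= 1.
Proof.
move=> mA; set C := no_return A K.
have mC : measurable C by exact: measurable_no_return.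
have bC : bmeas (\1_C : T -> R) by exact: bmeas_indic.
rewrite -(expect_indic mu mC) mulrC -(expect_birkhoff mf inv _ bC).
rewrite -[leRHS](expect_cst mu); apply: le_expect => [||x].
- exact: bmeas_birkhoff.
- exact: bmeas_cst.
have [[i Ci]|nC] := pselect (exists i : 'I_K.+1, C (iter i f x)); last first.
  rewrite big1 // => j _; rewrite indicE memNset// => Cj; apply: nC; by exists j.
rewrite (bigD1 i)//= indicE mem_set//= big1 ?addr0// => j /eqP ji.
rewrite indicE memNset// => Cj.
have key (a b : 'I_K.+1) : (a < b)%N -> C (iter a f x) -> C (iter b f x) -> False.
  move=> ab [_ Ca] [Ab _]; apply: (Ca (b - a)%N).
    rewrite subn_gt0 ab /=; apply: leq_trans (leq_subr _ _) _.
    by rewrite -ltnS.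
  by rewrite -iterD subnK// ltnW.
case: (ltngtP i j) => ij; [exact: (key i j)|exact: (key j i)|].
by apply: ji; apply/val_inj.
Qed.

(** The points that lie in infinitely many [B i n], for some [i], form a set that
    [f] maps into itself: by ergodicity it is negligible or of full measure. In
    the second case almost every point lies in [B' n] for some arbitrarily
    large [n], and, up to a small event, for some [n] in a bounded window. The
    index [i] absorbs the loss of one letter when [f] is applied. *)
Lemma io_dichotomy (B : nat -> nat -> set T) (B' : nat -> set T) :
  (forall i n, measurable (B i n)) -> (forall n, measurable (B' n)) ->
  (forall i n, B i n.+1 `<=` f @^-1` B i.+1 n) ->
  (forall i, exists N, forall n, (N <= n)%N -> B i n `<=` B' n) ->
  {ae mu, forall x, exists n0, forall n, (n0 <= n)%N -> ~ B 0%N n x} \/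
  (forall M eta, 0 < eta -> exists M',
     pr mu (~` \bigcup_(n in [set n | (M <= n < M + M')%N]) B' n) < eta).
Proof.
move=> mB mB' BS BB'.
have mlim i : measurable (lim_sup_set (B i)).
  by apply: bigcapT_measurable => n; apply: bigcup_measurable => k _.
pose E := \bigcup_i lim_sup_set (B i).
have mE : measurable E by exact: bigcupT_measurable.
have Einv : E `<=` f @^-1` E.
  move=> x [i _ xi]; exists i.+1 => // N _; have [n /= Nn Bn] := xi N.+1 I.
  case: n Nn Bn => [//|n] Nn Bn; exists n; first by rewrite /= -ltnS.
  exact: BS Bn.
have [E0|E1] := ergodic_subinvariant mf inv erg mE Einv; [left|right].
  exists E; split => // x /= H; exists 0%N => // n _; apply: contrapT => nB.
  by apply: H; exists n => k nk Bk; apply: nB; exists k.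
move=> M eta eta0.
pose F m := \bigcup_(n in [set n | (M <= n < M + m)%N]) B' n.
have mF m : measurable (F m) by apply: bigcup_measurable => n _.
apply: (@pr_bigcup_incr _ _ _ mu F eta) => //.
  move=> m x [n /= /andP[Mn nM] Bn]; exists n => //=.
  by rewrite Mn (leq_trans nM)// leq_add2l.
have : mu (~` E) = 0%E by rewrite probability_setC// -[X in (1 - X)%E]/(mu _) E1 subee.
apply: subset_measure0.
- by apply: measurableC; exact: bigcupT_measurable.
- exact: measurableC.
- apply: subsetC => x [i _ xi]; have [N HN] := BB' i.
  have [n /= Nn Bn] := xi (maxn N M) I.
  rewrite geq_max in Nn; case/andP: Nn => Nn Mn.
  exists (n - M).+1 => //; exists n; last exact: HN.
  by rewrite /= Mn addnS subnKC// ltnSn.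
Qed.

Variables (A : finType) (xi : T -> A).
Hypothesis mxi : forall a, measurable (xi @^-1` [set a]).

Local Notation itin := (itin f xi).
Local Notation rate := (rate mu f xi).
Local Notation p := (cyl_pr mu f xi).

(** Upper bound of Ornstein and Weiss on return times. In the cylinder of a given
    word, the points that do not return before time [exp (s n)] have measure at
    most [exp (- s n)]; there are only [exp (s' n)] typical words, with
    [s' < s], and the Borel-Cantelli lemma applies. *)
Lemma eventually_returns s : rate < s ->
  {ae mu, forall x, exists n0, forall n, (n0 <= n)%N ->
    exists m, [/\ (1 <= m)%N, m%:R <= expR (s * n%:R) &
      itin n (iter m f x) = itin n x]}.
Proof.
move=> rs; pose s' := (rate + s) / 2.
have rs' : rate < s' by rewrite /s'; lra.
have [Ty [Tyc Tya]] := typical_words mf inv mxi erg rs'.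
pose K n := Num.truncn (expR (s * n%:R)).
pose C n w := no_return (cylinder f xi w) (K n).
have mcyl := measurable_cylinder mf mxi.
have mC n w : measurable (C n w) by exact: measurable_no_return.
pose Bad n := \bigcup_(w in [set w | Ty w /\ w \in words A n]) C n w.
have mBad n : measurable (Bad n).
  apply: fin_bigcup_measurable => //.
  apply: (@sub_finite_set _ _ [set` words A n]); first by move=> w [].
  exact: finite_seq.
have prC n w : pr mu (C n w) <= expR (- (s * n%:R)).
  have h := pr_no_return (K n) (mcyl w).
  rewrite expRN -[leRHS]mul1r ler_pdivlMr ?expR_gt0//.
  apply: le_trans h; rewrite ler_wpM2l ?pr_ge0//.
  by rewrite ltW// truncnS_gt.
have prBad n : pr mu (Bad n) <= 1 * expR (- (s - s')) ^+ n.
  apply: (@le_trans _ _ (\sum_(w <- [seq w <- words A n | Ty w]) pr mu (C n w))).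
    apply: pr_cover_le => // x [w [Tw wn] Cw]; exists w => //.
    by rewrite mem_filter Tw.
  apply: (@le_trans _ _ (\sum_(w <- [seq w <- words A n | Ty w]) expR (- (s * n%:R)))).
    exact: ler_sum.
  rewrite big_const_seq count_predT size_filter iter_addr_0 -[leLHS]mulr_natl.
  apply: le_trans (ler_wpM2r (expR_ge0 _) (Tyc n)) _.
  by rewrite -expRD mul1r -expRM_natr ler_expR; lra.
have th : 0 <= expR (- (s - s')) < 1.
  by rewrite expR_ge0 expR_lt1 oppr_lt0 /s'; lra.
move: Tya (borel_cantelli_geometric mBad th prBad).
apply: filterS2 => x [n1 H1] [n2 H2]; exists (maxn n1 n2) => n.
rewrite geq_max => /andP[n1n n2n]; apply: contrapT => H.
apply: (H2 n n2n); exists (itin n x).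
  by split; [exact: H1|rewrite mem_words size_itin].
split; first by rewrite /cylinder/= size_itin.
move=> m /andP[m1 mK]; rewrite /cylinder/= size_itin => e; apply: H; exists m.
split => //; apply: le_trans (_ : (K n)%:R <= _); first by rewrite ler_nat.
by rewrite truncn_le expR_ge0.
Qed.

(** If a non-negligible set of points lay in infinitely many [B 0 n], almost every
    itinerary could be cut, by [io_dichotomy], into blocks taken from a codebook
    of rate [c], and the block code would bring the entropy rate down to [c]. *)
Lemma coded_rarely (B : nat -> nat -> set T) (B' : nat -> set T) (c : R) :
  (forall i n, measurable (B i n)) -> (forall n, measurable (B' n)) ->
  (forall i n, B i n.+1 `<=` f @^-1` B i.+1 n) ->
  (forall i, exists N, forall n, (N <= n)%N -> B i n `<=` B' n) ->
  0 <= c < rate ->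
  (forall eta, 0 < eta -> exists (M0 : nat) (G : set T) (D : seq A -> seq A -> bool)
      (L : nat -> nat),
    [/\ measurable G, pr mu (~` G) < eta,
      forall n v, (M0 <= n)%N ->
        \sum_(u <- words A n) (D u v)%:R <= expR (c * n%:R) &
      forall n x l, (M0 <= n)%N -> G x -> B' n x -> (L n <= l)%N ->
        D (itin n x) (itin l (iter n f x))]) ->
  {ae mu, forall x, exists n0, forall n, (n0 <= n)%N -> ~ B 0%N n x}.
Proof.
move=> mB mB' BS BB' /andP[c0 cr] HD.
have [//|HM] := io_dichotomy mB mB' BS BB'; exfalso.
pose eps := (rate - c) / 4; have e0 : 0 < eps by rewrite /eps; lra.
pose b := ln (2 * #|A|%:R) : R.
have b0 : 0 < b.
  rewrite /b ln_gt0//; have : (1 : R) <= #|A|%:R by rewrite ler1n (card_alphabet_gt0 mu mf mxi).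
  by lra.
pose eta := eps / b; have eta0 : 0 < eta by rewrite divr_gt0.
have [M0 [G [D [L [mG G1 Dc DG]]]]] := HD eta eta0.
have [M1 M10 HM1] := expR_tail_half e0.
pose M := maxn M0 M1.
have [M' HM'] := HM M eta eta0.
pose U := \bigcup_(n in [set n | (M <= n < M + M')%N]) B' n.
have mU : measurable U by apply: bigcup_measurable => n _.
have mGU : measurable (G `&` U) by exact: measurableI.
pose L' := (\max_(n < M + M') L n)%N.
have hGU x : (G `&` U) x -> exists2 n, (M <= n < M + M')%N &
    forall l, (L' <= l)%N -> D (itin n x) (itin l (iter n f x)).
  move=> [Gx [n /= nM Bn]]; exists n => // l Ll.
  have [Mn nM'] := andP nM.
  apply: DG => //; first by rewrite (leq_trans _ Mn)// leq_maxl.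
  apply: leq_trans Ll; exact: (leq_bigmax (Ordinal nM')).
have M00 : (0 < M)%N by rewrite (leq_trans M10)// leq_maxr.
have ce0 : 0 <= c + eps by lra.
have Dc' n v : (M <= n < M + M')%N ->
    \sum_(u <- words A n) (D u v)%:R <= expR (c * n%:R).
  by move=> /andP[Mn _]; apply: Dc; rewrite (leq_trans _ Mn)// leq_maxl.
have := rate_le_block_code mf inv mxi M00 mGU ce0 Dc' (HM1 M M' (leq_maxr _ _)) hGU.
have h : pr mu (~` (G `&` U)) <= pr mu (~` G) + pr mu (~` U).
  by rewrite setCI; apply: prU_le; exact: measurableC.
have : pr mu (~` (G `&` U)) * b < 2 * eps.
  rewrite -ltr_pdivlMr//; apply: le_lt_trans h _.
  by rewrite -mulrA -/eta; lra.
by rewrite /b /eps; lra.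
Qed.

End Returns.

Section LowerBounds.
Context (d : measure_display) (T : measurableType d) (R : realType).
Variables (mu : probability T R) (f : T -> T).
Hypotheses (mf : measurable_fun setT f) (inv : invariant_measure mu f).
Hypothesis erg : ergodic_measure mu f.
Variables (A : finType) (xi : T -> A).
Hypothesis mxi : forall a, measurable (xi @^-1` [set a]).

Local Notation itin := (itin f xi).
Local Notation rate := (rate mu f xi).

Lemma measurable_ex_itin (Q : nat -> Prop) (n : nat -> nat) :
  measurable [set x | exists m, Q m /\ itin (n m) (iter m f x) = itin (n m) x].
Proof.
rewrite (_ : [set _ | _] = \bigcup_(m in Q)
    [set x | itin (n m) (iter m f x) = itin (n m) x]); last first.
  by apply/seteqP; split => x [m] => [[]|] Qm e; exists m.
apply: bigcup_measurable => m _.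
have := measurable_itin mf mxi
  (fun w => take (n m) (drop m w) = take (n m) w) (m + n m).
rewrite [X in measurable X -> _](_ : _ =
  [set x | itin (n m) (iter m f x) = itin (n m) x])//.
apply/seteqP; split => x /=; rewrite drop_itin ?leq_addr// addKn;
  by rewrite !take_itin ?leq_addl.
Qed.

(** The block [u] is recovered from [m] and from its future [v] letter by letter,
    starting from its right end, even when the two occurrences overlap. *)
Lemma repeat_inj (u u' v : seq A) m : (0 < m)%N -> size u = size u' ->
  take (size u) (drop m (u ++ v)) = u ->
  take (size u') (drop m (u' ++ v)) = u' -> u = u'.
Proof.
move=> m0 su e e'.
case: u => [|a0 u0] in su e *; first by case: (u') su.
set u := a0 :: u0 in su e *; set n := size u in su e *.
have key k i : (n + size v - i <= k)%N -> (i < n + size v)%N ->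
    nth a0 (u ++ v) i = nth a0 (u' ++ v) i.
  elim: k i => [|k IH] i ik il; first by lia.
  have [iu|ui] := ltnP i n; last by rewrite !nth_cat -su -/n ltnNge ui.
  have im : (m + i < n + size v)%N.
    have := congr1 size e; rewrite size_take size_drop size_cat -/n.
    by case: ltnP => ? ?; lia.
  rewrite !nth_cat -su -/n iu -{1}e -{1}e' -su !nth_take// !nth_drop.
  by apply: IH => //; lia.
apply: (@eq_from_nth _ a0) => // i iu.
have := key _ i (leqnn _); rewrite ltn_addr// => /(_ isT).
by rewrite !nth_cat -su iu.
Qed.

(** Lower bound of Ornstein and Weiss: given its future, a block that returns
    before time [exp (c n)] is determined by its return time, hence is one of at
    most [exp (c n)]. *)
Lemma eventually_no_return c : 0 <= c < rate ->
  {ae mu, forall x, exists n0, forall n, (n0 <= n)%N -> forall m, (1 <= m)%N ->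
    m%:R <= expR (c * n%:R) -> itin n (iter m f x) <> itin n x}.
Proof.
move=> /andP[c0 cr]; pose c' := (c + rate) / 2.
pose B i n := [set x | exists m, ((1 <= m)%N /\ m%:R <= expR (c * (n + i)%:R)) /\
  itin n (iter m f x) = itin n x].
pose B' n := [set x | exists m, ((1 <= m)%N /\ m%:R <= expR (c' * n%:R)) /\
  itin n (iter m f x) = itin n x].
have mB i n : measurable (B i n).
  exact: (measurable_ex_itin (fun m => (1 <= m)%N /\ m%:R <= expR (c * (n + i)%:R))
    (fun=> n)).
have mB' n : measurable (B' n).
  exact: (measurable_ex_itin (fun m => (1 <= m)%N /\ m%:R <= expR (c' * n%:R))
    (fun=> n)).
have cc' : 0 < c' - c by rewrite /c'; lra.
have : {ae mu, forall x, exists n0, forall n, (n0 <= n)%N -> ~ B 0%N n x}.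
  apply: (@coded_rarely _ _ _ mu f mf inv erg A xi mxi B B' c') => //.
  - move=> i n x [m [[m1 mc]]]; rewrite !itinS -iterS iterSr => -[_ e]; exists m.
    by rewrite addnS -addSn.
  - move=> i; exists (Num.truncn (c * i%:R / (c' - c))).+1 => n nN x [m [[m1 mc] e]].
    exists m; split => //; split => //; apply: le_trans mc _; rewrite ler_expR.
    have : c * i%:R < n%:R * (c' - c).
      rewrite -ltr_pdivrMr//; apply: lt_le_trans (truncnS_gt _) _.
      by rewrite ler_nat.
    by rewrite natrD; lra.
  - by rewrite /c'; lra.
  move=> eta eta0; pose K n := Num.truncn (expR (c' * n%:R)).
  exists 0%N, setT, (fun u v =>
    has (fun m => take (size u) (drop m (u ++ v)) == u) (iota 1 (K (size u)))), K.
  split => //.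
  - by rewrite setCT /pr measure0.
  - move=> n v _; apply: (@le_trans _ _ (K n)%:R); last by rewrite truncn_le expR_ge0.
    rewrite sum_pred_words ler_nat -[X in (_ <= X)%N](size_iota 1).
    pose F u m := take n (drop m (u ++ v)) == u.
    pose h u := nth 0%N (iota 1 (K n)) (find (F u) (iota 1 (K n))).
    have hP u : has (F u) (iota 1 (K n)) -> h u \in iota 1 (K n) /\ F u (h u).
      by move=> hu; split; [rewrite mem_nth -?has_find|exact: (nth_find 0%N hu)].
    apply: (@count_le_inj _ _ _ _ h).
      by move=> u su; rewrite su => /hP[].
    move=> u u' su su'; rewrite su su' => /hP[+ /eqP e] /hP[_ /eqP e'] hh.
    rewrite mem_iota => /andP[m0 _].
    by apply: (@repeat_inj u u' v (h u)); rewrite // ?su ?su'// hh.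
  - move=> n x l _ _ [m [[m1 mc] e]] Kl; apply/hasP; exists m.
      rewrite mem_iota m1 size_itin add1n ltnS.
      by rewrite /K truncn_ge_nat ?expR_ge0.
    have mK : (m <= K n)%N by rewrite /K truncn_ge_nat ?expR_ge0.
    rewrite -itin_cat drop_itin; last by rewrite (leq_trans mK)// (leq_trans Kl)// leq_addl.
    by rewrite size_itin take_itin ?e//; lia.
apply: filterS => x [n0 H]; exists n0 => n nn m m1 mc e; apply: (H n nn).
by exists m; rewrite addn0.
Qed.

Lemma period_inj (u u' : seq A) k n : (0 < k)%N -> size u = n -> size u' = n ->
  drop k u = take (n - k) u -> drop k u' = take (n - k) u' ->
  take k u = take k u' -> u = u'.
Proof.
move=> k0 su su' e e' kk; case: u => [|a0 u0] in su e kk *.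
  by case: (u') su su' => // a u1 <-.
set u := a0 :: u0 in su e kk *.
apply: (@eq_from_nth _ a0) => [|i]; first by rewrite su su'.
rewrite su; elim/ltn_ind: i => i IH il.
have [ik|ki] := ltnP i k.
  by rewrite -(nth_take _ ik) kk nth_take.
have h (w : seq A) : drop k w = take (n - k) w -> nth a0 w i = nth a0 w (i - k).
  move=> ew; rewrite -{1}(subnKC ki) -nth_drop ew nth_take//; lia.
by rewrite h// [RHS]h// IH//; lia.
Qed.

(** A word of length [n] with a period [k <= c n] is determined by its first [k]
    letters. These form a typical word, except when [k] is bounded, so there are
    about [exp (c n rate)] such words, fewer than the entropy permits. *)
Lemma eventually_no_overlap (c : R) : 0 <= c < 1 -> 0 < rate ->
  {ae mu, forall x, exists n0, forall n, (n0 <= n)%N -> forall k, (1 <= k)%N ->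
    k%:R <= c * n%:R -> itin (n - k) (iter k f x) <> itin (n - k) x}.
Proof.
move=> /andP[c0 c1] r0; pose c' := (c + 1) / 2.
have [cc' c'1] : c < c' /\ c' < 1 by rewrite /c'; lra.
pose B i n := [set x | exists k, ((1 <= k)%N /\ k%:R <= c * (n + i)%:R) /\
  itin (n - k) (iter k f x) = itin (n - k) x].
pose B' n := [set x | exists k, ((1 <= k)%N /\ k%:R <= c' * n%:R) /\
  itin (n - k) (iter k f x) = itin (n - k) x].
have mB i n : measurable (B i n).
  exact: (measurable_ex_itin (fun k => (1 <= k)%N /\ k%:R <= c * (n + i)%:R)
    (fun k => (n - k)%N)).
have mB' n : measurable (B' n).
  exact: (measurable_ex_itin (fun k => (1 <= k)%N /\ k%:R <= c' * n%:R)
    (fun k => (n - k)%N)).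
(* e is small enough for the codebook to have a rate s c' + e < rate *)
pose e := rate * (1 - c') / 4; pose s := rate + e.
have e0 : 0 < e by rewrite divr_gt0// mulr_gt0// subr_gt0.
have rs : rate < s by rewrite /s; lra.
have [Ty [Tyc Tya]] := typical_words mf inv mxi erg rs.
have : {ae mu, forall x, exists n0, forall n, (n0 <= n)%N -> ~ B 0%N n x}.
  apply: (@coded_rarely _ _ _ mu f mf inv erg A xi mxi B B' (s * c' + e)) => //.
  - move=> i n x [k [[k1 kc] ekx]]; exists k; split.
      by split; rewrite // addnS -addSn.
    have [kn|nk] := leqP k n; last first.
      by rewrite (_ : (n - k)%N = 0%N)//; lia.
    by move: ekx; rewrite subSn// !itinS -iterS iterSr => -[].
  - move=> i; exists (Num.truncn (c * i%:R / (c' - c))).+1 => n nN x [m [[m1 mc] em]].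
    exists m; split => //; split => //; apply: le_trans mc _.
    have : c * i%:R < n%:R * (c' - c).
      rewrite -ltr_pdivrMr; last by lra.
      by apply: lt_le_trans (truncnS_gt _) _; rewrite ler_nat.
    by rewrite natrD; lra.
  - apply/andP; split; first by rewrite addr_ge0 ?mulr_ge0//; lra.
    have h : 0 < rate * (1 - c') * (3 - c') by rewrite !mulr_gt0//; lra.
    by rewrite /s /e; move: h; clear; move: c' (rate) => c' r; lra.
  move=> eta eta0.
  pose G k0 := \bigcap_k [set x | (k0 <= k)%N -> Ty (itin k x)].
  have mG k0 : measurable (G k0).
    apply: bigcapT_measurable => k.
    exact: (measurable_itin mf mxi (fun w => (k0 <= k)%N -> Ty w)).
  have [k0 Gk0] : exists k0, pr mu (~` G k0) < eta.
    apply: (@pr_bigcup_incr _ _ _ mu G eta) => //.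
      by move=> k0 x Gx k _ kk; apply: (Gx k I); exact: ltnW.
    move: Tya => [N [mN N0 NT]]; apply: subset_measure0 N0 => //.
      by apply: measurableC; exact: bigcupT_measurable.
    move=> x nG; apply: NT => -[n0 H]; apply: nG; exists n0 => // k _ kk.
    exact: H.
  pose Q : R := (#|A| ^ k0)%:R.
  have Q0 : 0 <= Q by [].
  have [|M0 HM0] := expR_absorb Q0 (a := s * c') _ e0.
    by rewrite mulr_ge0//; lra.
  pose K n := Num.truncn (c' * n%:R).
  have Kn n : (K n <= n)%N.
    by rewrite -(ler_nat R) (le_trans (_ : _ <= c' * n%:R))// ?truncn_le ?mulr_ge0 ?ler_piMl//; lra.
  have cn0 n : 0 <= c' * n%:R by rewrite mulr_ge0//; lra.
  pose F k (u : seq A) := (drop k u == take (size u - k) u) &&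
     ((k < k0)%N || Ty (take k u)).
  exists M0, (G k0), (fun u v => has (F^~ u) (iota 1 (K (size u)))), (fun=> 0%N).
  split => //.
  - move=> n v nM; apply: le_trans (HM0 n nM).
    apply: (@le_trans _ _ (\sum_(k <- iota 1 (K n)) (count (F k) (words A n))%:R)).
      under [leRHS]eq_bigr do rewrite -sum_pred_words.
      rewrite exchange_big /=; apply: ler_sum_words => u su; rewrite su.
      case: (boolP (has _ _)) => [/hasP[k kK Fk]|_]; last exact: sumr_ge0.
      rewrite (big_rem _ kK)/= Fk lerDl; exact: sumr_ge0.
    apply: (@le_trans _ _ (\sum_(k <- iota 1 (K n)) (Q + expR (s * c' * n%:R)))).
      apply: ler_sum_mem => k; rewrite mem_iota add1n ltnS => /andP[k1 kK].
      have kn : (k <= n)%N := leq_trans kK (Kn n).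
      pose P w := (k < k0)%N || Ty w.
      apply: (@le_trans _ _ (count P (words A k))%:R).
        rewrite ler_nat -[X in (_ <= X)%N]size_filter; apply: (@count_le_inj _ _ _ _ (take k)).
          move=> w sw /andP[_ Pw]; rewrite mem_filter /P Pw mem_words size_takel ?sw//=.
        move=> u u' su su' /andP[/eqP + _] /andP[/eqP + _].
        by rewrite su su'; exact: period_inj.
      have [kk0|k0k] := ltnP k k0.
        rewrite -[leLHS]addr0 lerD ?expR_ge0// ler_nat (leq_trans (count_size _ _))//.
        by rewrite size_words leq_pexp2l ?(card_alphabet_gt0 mu mf mxi)// ltnW.
      rewrite -[leLHS]add0r lerD//.
      rewrite (@eq_count _ P Ty); last by move=> w; rewrite /P ltnNge k0k.
      apply: le_trans (Tyc k) _; rewrite ler_expR -mulrA ler_wpM2l//; first by lra.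
      by apply: le_trans (_ : (K n)%:R <= _); rewrite ?ler_nat// truncn_le.
    rewrite big_const_seq count_predT size_iota iter_addr_0 -[leLHS]mulr_natl.
    by rewrite ler_wpM2r ?ler_nat// addr_ge0 ?expR_ge0.
  - move=> n x l nM Gx [k [[k1 kc] ek]] _; apply/hasP.
    have kK : (k <= K n)%N by rewrite /K truncn_ge_nat.
    have kn := leq_trans kK (Kn n).
    exists k; first by rewrite size_itin mem_iota add1n k1 ltnS.
    rewrite /F size_itin drop_itin// take_itin ?leq_subr// ek eqxx /= take_itin//.
    by case: ltnP => //= k0k; exact: Gx.
apply: filterS => x [n0 H]; exists n0 => n nn k k1 kc ek; apply: (H n nn).
by exists k; rewrite addn0.
Qed.

End LowerBounds.

(** * Comparison with the metric entropy *)

Section SumWords.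
Variables (A : finType) (R : realType).

Definition ffun_word n (w : {ffun 'I_n -> A}) : seq A := map w (enum 'I_n).

Lemma size_ffun_word n w : size (@ffun_word n w) = n.
Proof. by rewrite size_map size_enum_ord. Qed.

Lemma nth_ffun_word n (w : {ffun 'I_n -> A}) a (i : 'I_n) :
  nth a (ffun_word w) i = w i.
Proof. by rewrite (nth_map i) ?size_enum_ord// nth_ord_enum. Qed.

Lemma perm_words n :
  perm_eq [seq ffun_word w | w : {ffun 'I_n -> A}] (words A n).
Proof.
apply: uniq_perm (uniq_words _ _) _.
  rewrite map_inj_uniq ?enum_uniq// => u v uv; apply/ffunP => i.
  have : nth (u i) (ffun_word u) i = nth (u i) (ffun_word v) i by rewrite uv.
  by rewrite !nth_ffun_word.
move=> w; rewrite mem_words; apply/mapP/eqP => [[u _ ->]|sw].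
  by rewrite size_ffun_word.
case: n sw => [|n] sw.
  exists [ffun i : 'I_0 => False_rect A (notF (ltn_ord i))]; first by rewrite mem_enum.
  by rewrite (size0nil sw) [RHS]size0nil// size_ffun_word.
case: w sw => [//|a w] sw.
exists [ffun i : 'I_n.+1 => nth a (a :: w) i]; first by rewrite mem_enum.
apply: (@eq_from_nth _ a); first by rewrite sw size_ffun_word.
move=> i; rewrite sw => il; rewrite -[i in RHS]/(nat_of_ord (Ordinal il)).
by rewrite nth_ffun_word ffunE.
Qed.

Lemma sum_ffun_words n (F : seq A -> R) :
  \sum_(w : {ffun 'I_n -> A}) F (ffun_word w) = \sum_(w <- words A n) F w.
Proof. by rewrite -(perm_big _ (perm_words n)) /= big_image. Qed.

End SumWords.

Section MetricEntropy.
Context (d : measure_display) (T : measurableType d) (R : realType).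
Variables (mu : probability T R) (f : T -> T).
Hypotheses (mf : measurable_fun setT f) (inv : invariant_measure mu f).

Lemma iterated_join_cylinder (I : finType) (xi : T -> I) n (w : {ffun 'I_n -> I}) :
  iterated_join f (fun i => xi @^-1` [set i]) w = cylinder f xi (ffun_word w).
Proof.
apply/seteqP; split => x /=; rewrite /iterated_join /cylinder /= size_ffun_word.
  move=> H; apply: (@eq_from_nth _ (xi x)).
    by rewrite size_itin size_ffun_word.
  move=> j; rewrite size_itin => jn.
  rewrite (nth_map x) ?size_traject// nth_traject//.
  rewrite -[j in RHS]/(nat_of_ord (Ordinal jn)) nth_ffun_word.
  exact: (H (Ordinal jn) Logic.I).
move=> e j _; rewrite /preimage/=.
have := congr1 (fun s => nth (xi x) s j) e.
rewrite (nth_map x) ?size_traject// nth_traject// => ->.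
by rewrite nth_ffun_word.
Qed.

Lemma entropy_rateE (I : finType) (xi : T -> I) :
  (forall i, measurable (xi @^-1` [set i])) ->
  entropy_rate mu f (fun i => xi @^-1` [set i]) = rate mu f xi.
Proof.
move=> mxi; rewrite /entropy_rate; apply/cvg_lim => //.
apply: cvg_trans (rate_cvg mf inv mxi); apply: near_eq_cvg.
apply: nearW => n; congr (_ / _); rewrite /partition_entropy /block_entropy.
rewrite -sum_ffun_words; congr (- _); apply: eq_bigr => w _.
by rewrite iterated_join_cylinder.
Qed.

Lemma rate_le_metric_entropy k (xi : T -> 'I_k) :
  (forall i, measurable (xi @^-1` [set i])) ->
  ((rate mu f xi)%:E <= metric_entropy mu f)%E.
Proof.
move=> mxi; apply: ereal_sup_ubound; exists k, (fun i => xi @^-1` [set i]).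
split; last by rewrite entropy_rateE.
split => //; first by apply/trivIsetP => i j _ _ /eqP ij; apply/seteqP;
  split => // x [/= xi1 xi2]; apply: ij; rewrite -xi1 -xi2.
by apply/seteqP; split => // x _; exists (xi x).
Qed.

Lemma metric_entropy_approx c : (c%:E < metric_entropy mu f)%E ->
  exists k (xi : T -> 'I_k), (forall i, measurable (xi @^-1` [set i])) /\
    c < rate mu f xi.
Proof.
move=> /ereal_sup_gt[_ [k [P [[mP tP cP] ->]]]]; rewrite lte_fin => cr.
have : forall x, exists i, P i x.
  by move=> x; have : [set: T] x by []; rewrite -cP => -[i _ ?]; exists i.
move=> /choice[xi Hxi]; exists k, xi.
have e : P = fun i => xi @^-1` [set i].
  apply/funext => i; apply/seteqP; split => x /=; last by move=> <-.
  move=> Pix; apply: contrapT => /eqP xii.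
  have /trivIsetP/(_ (xi x) i I I xii) := tP.
  by move/seteqP => [/(_ x) + _]; apply; split.
split; first by move=> i; have := mP i; rewrite e.
by move: cr; rewrite e entropy_rateE// => i; have := mP i; rewrite e.
Qed.

(** Continuity of the entropy rate. A word of [xi] is coded by a word of [eta]
    and by corrections: a letter of [eta] is kept with weight [1 - b] and
    replaced by any letter with weight [b / #|A|], so that correcting it costs
    [ln (#|A| / b)] and happens only where [xi] and [eta] differ. *)
Section Compare.
Variables (A : finType) (xi eta : T -> A).
Hypothesis mxi : forall a, measurable (xi @^-1` [set a]).
Hypothesis meta : forall a, measurable (eta @^-1` [set a]).
Variable b : R.
Hypothesis b01 : 0 < b < 1.

Let kap (z : A * A) : R := (1 - b) * (z.1 == z.2)%:R + b / #|A|%:R.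

Let kaps (w : seq (A * A)) : R := \prod_(z <- w) kap z.

Let A0 : 0 < #|A|%:R :> R.
Proof. by rewrite ltr0n (card_alphabet_gt0 mu mf mxi). Qed.

Let kap_gt0 z : 0 < kap z.
Proof.
have [b0 b1] := andP b01; rewrite /kap ltr_pwDr ?mulr_ge0 ?divr_gt0// subr_ge0 ltW//.
Qed.

Let kaps_gt0 w : 0 < kaps w.
Proof. exact: prodr_gt0. Qed.

Let kap_sum a' : \sum_a kap (a, a') = 1.
Proof.
rewrite big_split /= -mulr_sumr (bigD1 a')//= eqxx big1 => [|a /negPf ->//].
by rewrite addr0 mulr1 sumr_const -[_ *+ #|_|]mulr_natr divfK ?subrK// gt_eqF//.
Qed.

Let kaps_sum n v : size v = n -> \sum_(u <- words A n) kaps (zip u v) = 1.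
Proof.
elim: n v => [|n IH] [|a' v]// sv; first by rewrite sum_words0 /kaps big_nil.
rewrite sum_wordsS; under eq_bigr => a _.
  under eq_bigr => w _ do rewrite /kaps /= big_cons.
  rewrite -mulr_sumr; over.
rewrite -mulr_suml kap_sum mul1r; apply: IH; by case: sv.
Qed.

Let zeta x := (xi x, eta x).

Let mzeta z : measurable (zeta @^-1` [set z]).
Proof.
rewrite (_ : _ @^-1` _ = (xi @^-1` [set z.1]) `&` (eta @^-1` [set z.2])).
  exact: measurableI.
by case: z => a a'; apply/seteqP; split => x /=; rewrite /zeta; [case=> <- <-|case=> -> ->].
Qed.

Let itin_fst n x : itin f xi n x = map fst (itin f zeta n x).
Proof. by rewrite /itin -map_comp. Qed.

Let itin_snd n x : itin f eta n x = map snd (itin f zeta n x).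
Proof. by rewrite /itin -map_comp. Qed.

Lemma rate_compare :
  rate mu f xi <=
  rate mu f eta - ln (1 - b) + pr mu [set x | xi x != eta x] * ln (#|A|%:R / b).
Proof.
have [b0 b1] := andP b01.
pose c := - ln (1 - b) + pr mu [set x | xi x != eta x] * ln (#|A|%:R / b).
have mne : measurable [set x | xi x != eta x].
  have := measurable_itin mf mzeta (fun w => if w is z :: _ then z.1 != z.2 else false) 1.
  by [].
pose p' := cyl_pr mu f eta.
pose q u := \sum_(v <- words A (size u)) p' v * kaps (zip u v).
have q_gt0 u : 0 < q u.
  have h : \sum_(v <- words A (size u)) p' v = 1 by exact: cyl_pr_sum.
  rewrite lt_neqAle; apply/andP; split; last first.
    by apply: sumr_ge0 => v _; rewrite mulr_ge0 ?cyl_pr_ge0// ltW.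
  apply/negP => /eqP/esym q0.
  suff : \sum_(v <- words A (size u)) p' v = 0.
    by rewrite h => /eqP; rewrite oner_eq0.
  rewrite big_seq big1// => v vw.
  have : p' v * kaps (zip u v) <= 0.
    rewrite -q0 /q (big_rem _ vw)/= lerDl sumr_ge0// => w _.
    by rewrite mulr_ge0 ?cyl_pr_ge0// ltW.
  rewrite pmulr_lle0// => pv; apply/eqP; rewrite eq_le pv; exact: cyl_pr_ge0.
pose loss (z : A * A) : R := - ln (1 - b) + (z.1 != z.2)%:R * ln (#|A|%:R / b).
have Ab : 0 < #|A|%:R / b by rewrite divr_gt0.
have lossE z : - ln (kap z) <= loss z.
  rewrite /loss lerNl -ler_expR lnK ?posrE// /kap.
  have h1 : 0 <= b / #|A|%:R by rewrite divr_ge0// ltW.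
  case: eqP => _ /=; rewrite ?mul0r ?addr0 ?opprK ?mul1r.
    by rewrite lnK ?posrE; lra.
  rewrite mulr0 add0r opprD opprK expRD expRN !lnK ?posrE ?subr_gt0//.
  by rewrite invf_div ger_pMl ?divr_gt0//; lra.
have main n : block_entropy mu f xi n <= block_entropy mu f eta n + n%:R * c.
  have : block_entropy mu f xi n <= expect mu (fun x => - ln (q (itin f xi n x))).
    apply: block_entropy_le => // [w|]; first exact: ltW.
    rewrite (@eq_sum_words _ _ _ _ (fun u => \sum_(v <- words A n) p' v * kaps (zip u v))).
      rewrite exchange_big /=.
      rewrite (@eq_sum_words _ _ _ _ p') ?cyl_pr_sum// => v sv.
      by rewrite -mulr_sumr kaps_sum// mulr1.
    by move=> u su; rewrite /q su.
  move=> /le_trans; apply.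
  apply: (@le_trans _ _ (expect mu (fun x => - ln (p' (itin f eta n x)) +
     \sum_(z <- itin f zeta n x) loss z))).
    under [X in expect mu X <= _]funext => x do rewrite itin_fst.
    under [X in _ <= expect mu X]funext => x do rewrite itin_snd.
    rewrite (expect_itin mu mf mzeta (fun w => - ln (q (map fst w)))).
    rewrite (expect_itin mu mf mzeta (fun w => - ln (p' (map snd w)) + \sum_(z <- w) loss z)).
    apply: ler_sum => w _.
    have := cyl_pr_ge0 mu f zeta w; rewrite le_eqVlt => /predU1P[<-|pw].
      by rewrite !mul0r.
    rewrite ler_pM2l//.
    have pw' : 0 < p' (map snd w).
      apply: lt_le_trans pw _; apply: le_pr; try exact: measurable_cylinder.
      by move=> x; rewrite /cylinder/= size_map itin_snd => ->.
    apply: (@le_trans _ _ (- ln (p' (map snd w) * kaps w))).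
      rewrite lerN2 ler_ln ?posrE ?mulr_gt0// /q.
      have vw : map snd w \in words A (size (map fst w)).
        by rewrite mem_words !size_map.
      rewrite (big_rem _ vw)/= zip_unzip lerDl sumr_ge0// => v _.
      by rewrite mulr_ge0 ?cyl_pr_ge0// ltW.
    rewrite lnM ?posrE ?kaps_gt0// opprD lerD2l.
    elim: (w) => [|z w' IH]; first by rewrite /kaps !big_nil ln1 oppr0.
    rewrite /kaps !big_cons lnM ?posrE ?kap_gt0 ?kaps_gt0// opprD lerD//.
  have bl : bmeas (fun x => loss (zeta x)).
    exact: (@bmeas_itin _ _ _ _ mf _ _ mzeta (fun w => if w is z :: _ then loss z else 0) 1).
  have e x : \sum_(z <- itin f zeta n x) loss z = \sum_(j < n) loss (zeta (iter j f x)).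
    rewrite /itin big_map; elim: n x => [|n IH] x; first by rewrite big_nil big_ord0.
    rewrite [traject _ _ _]/= big_cons big_ord_recl IH; congr (_ + _).
    by apply: eq_bigr => j _; rewrite -iterSr.
  under [X in expect mu X]funext => x do rewrite e.
  rewrite expectD; last 2 first.
  - exact: (@bmeas_itin _ _ _ _ mf _ _ meta (fun w => - ln (p' w))).
  - exact: (bmeas_birkhoff mf n bl).
  rewrite (expect_itin mu mf meta (fun w => - ln (p' w))) (expect_birkhoff mf inv n bl).
  rewrite /block_entropy -sumrN; apply: lerD.
    by apply: ler_sum => w _; rewrite mulrN.
  rewrite ler_wpM2l// /loss expectD; last 2 first.
  - exact: bmeas_cst.
  - under [X in bmeas X]funext => x do rewrite mulrC.
    apply: bmeasZ.
    exact: (@bmeas_itin _ _ _ _ mf _ _ mzeta (fun w => if w is z :: _ then (z.1 != z.2)%:R else 0) 1).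
  rewrite expect_cst /c lerD2l.
  under [X in expect mu X]funext => x do rewrite mulrC.
  rewrite expectZ; last first.
    exact: (@bmeas_itin _ _ _ _ mf _ _ mzeta (fun w => if w is z :: _ then (z.1 != z.2)%:R else 0) 1).
  rewrite mulrC -expect_indic//.
  rewrite (_ : (fun x => _) = \1_[set x | xi x != eta x])//.
  apply/funext => x; rewrite indicE; congr (_%:R).
  by case: (boolP (xi x != eta x)) => h; [rewrite mem_set|rewrite memNset//; exact/negP].
rewrite -addrA -/c.
have h := rate_cvg mf inv meta.
rewrite -lerBlDr -(cvg_lim _ h)//; apply: limr_ge; first exact: (cvgP _ h).
exists 1%N => // n /= n0; have n0' : 0 < n%:R :> R by rewrite ltr0n.
rewrite ler_pdivlMr// mulrBl; have := rate_block mf inv mxi n; have := main n.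
by lra.
Qed.

End Compare.
End MetricEntropy.

(** * Partitions of a metric space with a controlled boundary *)

Lemma open_mball (R : realType) (X : metricType R) (x : X) (r : R) :
  open (ball x r).
Proof.
rewrite openE => y; rewrite ballEmdist /= => xy; rewrite /interior -nbhs_ballE.
exists (r - mdist x y); first by rewrite /= subr_gt0.
move=> z; rewrite !ballEmdist /= => yz.
by apply: le_lt_trans (metric_triangle x y z) _; lra.
Qed.

Section Regularity.
Context (R : realType) (X : pmetricType R).
Variable mu : probability (borel X) R.

Lemma open_borel (U : set X) : open U -> measurable (U : set (borel X)).
Proof. by move=> oU; exact: sub_sigma_algebra. Qed.

Lemma closed_borel (U : set X) : closed U -> measurable (U : set (borel X)).
Proof.
move=> cU; rewrite -[U]setCK; apply: measurableC; apply: open_borel.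
exact: closed_openC.
Qed.

Let regular (A : set X) := forall e : R, 0 < e -> exists K U : set X,
  [/\ closed K, open U, K `<=` A, A `<=` U & pr mu (U `\` K) < e].

Let mDUK (K U : set X) : closed K -> open U -> measurable (U `\` K : set (borel X)).
Proof.
by move=> cK oU; apply: measurableD; [exact: open_borel|exact: closed_borel].
Qed.

Let regular_open (U : set X) : open U -> regular U.
Proof.
move=> oU e e0.
pose r n : R := n.+1%:R^-1.
have r0 n : 0 < r n by rewrite invr_gt0 ltr0n.
pose F n : set X := ~` \bigcup_(y in ~` U) ball y (r n).
have cF n : closed (F n).
  apply: open_closedC; apply: bigcup_open => y _.
  exact: open_mball.
have FU n : F n `<=` U.
  move=> x Fx; apply: contrapT => Ux; apply: Fx; exists x => //.
  exact: ballxx.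
have [n hn] : exists n, pr mu (U `\` F n) < e.
  apply: pr_bigcup_decr => //.
  - by move=> n; exact: mDUK.
  - move=> n x [Ux nF]; split => // Fx; apply: nF => -[y Uy xy].
    apply: Fx; exists y => //; apply: le_ball xy.
    by rewrite lef_pV2 ?posrE ?ltr0n// ler_nat.
  rewrite (_ : \bigcap_n _ = set0) ?measure0//.
  apply/seteqP; split => // x H.
  have [Ux _] := H 0%N I.
  have : nbhs x U by exact: open_nbhs_nbhs.
  rewrite -nbhs_ballE => -[d /= d0 dU].
  have [m md] : exists m, r m < d.
    exists (Num.truncn d^-1); rewrite /r invf_plt ?posrE//.
    exact: truncnS_gt.
  have [_] := H m I; apply => -[y Uy xy]; apply: Uy; apply: dU.
  by apply: ball_sym; apply: le_ball xy; exact: ltW.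
by exists (F n), U; split.
Qed.

Let regularC (A : set X) : regular A -> regular (~` A).
Proof.
move=> rA e e0; have [K [U [cK oU KA AU h]]] := rA e e0.
exists (~` U), (~` K); split; [exact: open_closedC|exact: closed_openC| | |].
- exact: subsetC.
- exact: subsetC.
by rewrite setDE setCK setIC -setDE.
Qed.

Let regular_bigcup (A : nat -> set X) : (forall i, regular (A i)) ->
  regular (\bigcup_i A i).
Proof.
move=> rA e e0.
have ei i : 0 < e / 2 / (2 ^ i.+1)%:R by rewrite !divr_gt0// ltr0n expn_gt0.
have /choice[K HK] : forall i, exists K : set X, exists U : set X,
    [/\ closed K, open U, K `<=` A i, A i `<=` U
    & pr mu (U `\` K) < e / 2 / (2 ^ i.+1)%:R] by move=> i; exact: rA.
have /choice[U HU] := HK.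
have cK i : closed (K i) by have [] := HU i.
have oU i : open (U i) by have [] := HU i.
have KA i : K i `<=` A i by have [] := HU i.
have AU i : A i `<=` U i by have [] := HU i.
have oUU : open (\bigcup_i U i) by exact: bigcup_open.
pose KN n := \bigcup_(i < n) K i.
have cKN n : closed (KN n) by apply: closed_bigcup => //; exact: finite_II.
have mK : measurable (\bigcup_i K i : set (borel X)).
  by apply: bigcupT_measurable => i; exact: closed_borel.
have mU : measurable (\bigcup_i U i : set (borel X)) by exact: open_borel.
have h1 : pr mu (\bigcup_i U i `\` \bigcup_i K i) <= e / 2.
  rewrite -lee_fin -prE; last exact: measurableD.
  apply: (@le_trans _ _ (\sum_(0 <= i <oo) mu (U i `\` K i))%E).
    apply: measure_sigma_subadditive => //.
    - by move=> i; exact: mDUK.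
    - exact: measurableD.
    - by move=> x [[i _ Ui] nK]; exists i => //; split => // Ki; apply: nK; exists i.
  apply: le_trans (epsilon_trick0 _ _ ) ; last by rewrite divr_ge0 ?ltW.
  apply: lee_nneseries => // i _; rewrite prE; last exact: mDUK.
  by rewrite lee_fin ltW//; have [] := HU i.
have [n hn] : exists n, pr mu (\bigcup_i K i `\` KN n) < e / 2.
  apply: pr_bigcup_decr; last by rewrite divr_gt0.
  - by move=> n; apply: measurableD => //; exact: closed_borel.
  - move=> n x [Kx nK]; split => // -[i /= im Ki]; apply: nK; exists i => //=.
    exact: ltnW.
  rewrite (_ : \bigcap_n _ = set0) ?measure0//.
  apply/seteqP; split => // x H; have [[i _ Ki] _] := H 0%N I.
  by have [_] := H i.+1 I; apply; exists i => /=.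
exists (KN n), (\bigcup_i U i); split => //.
- by move=> x [i _ /KA Ai]; exists i.
- by move=> x [i _ /AU Ai]; exists i.
apply: le_lt_trans (_ : pr mu ((\bigcup_i U i `\` \bigcup_i K i) `|`
   (\bigcup_i K i `\` KN n)) < _).
  apply: le_pr; [exact: mDUK| |].
    by apply: measurableU; apply: measurableD => //; exact: closed_borel.
  move=> x [Ux nK]; have [Kx|Kx] := pselect ((\bigcup_i K i) x); [right|left] => //.
apply: le_lt_trans (prU_le _ _ _) _; [exact: measurableD| |].
  by apply: measurableD => //; exact: closed_borel.
by lra.
Qed.

(** The sets squeezed between a closed and an open set up to any positive
    probability form a sigma-algebra that contains the open sets. *)
Lemma inner_regular (A : set (borel X)) (e : R) : measurable A -> 0 < e ->
  exists K : set X, [/\ closed K, K `<=` A & pr mu (A `\` K) < e].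
Proof.
move=> mA e0; have rA : regular A.
  apply: (@smallest_sub _ (sigma_algebra setT) (@open X) regular _ _ A mA).
    split.
    - by apply: regular_open; exact: open0.
    - by move=> B rB; rewrite setTD; exact: regularC.
    - by move=> F rF; exact: regular_bigcup.
  by move=> U oU; exact: regular_open.
have [K [U [cK oU KA AU h]]] := rA e e0; exists K; split => //.
apply: le_lt_trans h; apply: le_pr; [|exact: mDUK|exact: setSD].
by apply: measurableD => //; exact: closed_borel.
Qed.

End Regularity.

(** Around [rho] the mass [m] decays at least like the square root of the radius.
    The point is the intersection of nested intervals: of the two middle
    quarters of an interval, keep one that has at most half of the mass. *)
Lemma exists_thin_level (R : realType) (m : R -> R -> R) (a b : R) : a < b ->
  (forall x y, x <= y -> 0 <= m x y) ->
  (forall x y z, x <= y -> y <= z -> m x y + m y z <= m x z) ->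
  exists rho, a < rho < b /\ forall j : nat,
    m (rho - (b - a) / 4 ^+ j.+1) (rho + (b - a) / 4 ^+ j.+1) <= m a b / 2 ^+ j.
Proof.
move=> ab m0 madd; pose l j : R := (b - a) / 4 ^+ j.
have l0 j : 0 < l j by rewrite divr_gt0 ?subr_gt0// exprn_gt0.
have lS j : l j.+1 = l j / 4 by rewrite /l exprS; field; rewrite expf_neq0.
pose next j x := if m (x + l j / 4) (x + l j / 2) <= m (x + l j / 2) (x + l j * 3 / 4)
  then x + l j / 4 else x + l j / 2.
pose s := fix s j := if j is j'.+1 then next j' (s j') else a.
have sS j : s j + l j / 4 <= s j.+1 /\ s j.+1 + l j.+1 <= s j + l j * 3 / 4.
  rewrite lS /= /next; have := l0 j; case: ifP => _; lra.
have mono x y x' y' : x' <= x -> x <= y -> y <= y' -> m x y <= m x' y'.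
  move=> h1 h2 h3; have := madd x' x y h1 h2; have := madd x' y y' (le_trans h1 h2) h3.
  by have := m0 x' x h1; have := m0 y y' h3; lra.
have mS j : m (s j) (s j + l j) <= m a b / 2 ^+ j.
  elim: j => [|j IH]; first by rewrite /= /l expr0 !divr1 addrC subrK.
  have lj := l0 j.
  have : m (s j.+1) (s j.+1 + l j.+1) <= m (s j) (s j + l j) / 2.
    have h : m (s j + l j / 4) (s j + l j / 2) +
             m (s j + l j / 2) (s j + l j * 3 / 4) <= m (s j) (s j + l j).
      apply: le_trans (madd _ _ _ _ _) _; [lra|lra|].
      by apply: mono; lra.
    rewrite lS /= /next; case: ifPn => h'.
      by rewrite (_ : s j + l j / 4 + l j / 4 = s j + l j / 2); lra.
    rewrite (_ : s j + l j / 2 + l j / 4 = s j + l j * 3 / 4); last by lra.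
    by move: h'; rewrite -ltNge; lra.
  have -> : m a b / 2 ^+ j.+1 = m a b / 2 ^+ j / 2.
    by rewrite exprS; field; rewrite expf_neq0.
  by move: IH; lra.
have sle j k : s j <= s (j + k)%N /\ s (j + k)%N + l (j + k)%N <= s j + l j.
  elim: k => [|k [IH1 IH2]]; first by rewrite addn0.
  have [h1 h2] := sS (j + k)%N; rewrite addnS; have := l0 (j + k)%N.
  by split; lra.
pose rho := sup [set s j | j in setT].
have sup_s : has_sup [set s j | j in setT].
  split; first by exists a; exists 0%N.
  exists (s 0%N + l 0%N) => _ [j _ <-]; have := (sle 0%N j).2; rewrite add0n.
  by have := l0 j; lra.
have rho_ge j : s j <= rho by apply: sup_upper_bound => //; exists j.
have rho_le j : rho <= s j + l j.
  apply: sup_le_ub; first by case: sup_s.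
  move=> _ [k _ <-]; have [jk|kj] := leqP j k.
    by have := (sle j (k - j)%N).2; rewrite subnKC//; have := l0 k; lra.
  by have := (sle k (j - k)%N).1; rewrite subnKC ?(ltnW kj)//; have := l0 j; lra.
have rho_in j : s j + l j / 4 <= rho /\ rho <= s j + l j * 3 / 4.
  have [h1 h2] := sS j; have := rho_ge j.+1; have := rho_le j.+1; lra.
exists rho; split.
  have l0E : l 0%N = b - a by rewrite /l expr0 divr1.
  by have := rho_in 0%N; rewrite l0E /=; move: ab; lra.
move=> j; apply: le_trans (mS j); have [h1 h2] := rho_in j; have := l0 j.
have -> : (b - a) / 4 ^+ j.+1 = l j / 4 by rewrite -lS.
by move=> lj; apply: mono; lra.
Qed.

Section Distance.
Context (R : realType) (X : metricType R).
Variable K : set X.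

(** The distance to [K], truncated at 1 so that [K] may be empty. *)
Definition dist1 (x : X) : R := inf [set r | r = 1 \/ exists2 y, K y & r = mdist x y].

Let lb x : has_lbound [set r | r = 1 \/ exists2 y, K y & r = mdist x y].
Proof. by exists 0 => r [->//|[y _ ->]]; exact: mdist_ge0. Qed.

Lemma dist1_ge0 x : 0 <= dist1 x.
Proof.
apply: lb_le_inf; first by exists 1; left.
by move=> r [->//|[y _ ->]]; exact: mdist_ge0.
Qed.

Lemma dist1_in x : K x -> dist1 x = 0.
Proof.
move=> Kx; apply/eqP; rewrite eq_le dist1_ge0 andbT -(mdistxx x).
by apply: ge_inf => //; right; exists x.
Qed.

Lemma dist1_lip x y : dist1 x <= dist1 y + mdist x y.
Proof.
rewrite -lerBlDr; apply: lb_le_inf; first by exists 1; left.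
move=> r [->|[z Kz ->]]; rewrite lerBlDr.
  have h : dist1 x <= 1 by apply: ge_inf => //; left.
  by apply: le_trans h _; rewrite lerDl mdist_ge0.
apply: (@le_trans _ _ (mdist x z)); first by apply: ge_inf => //; right; exists z.
by rewrite addrC; exact: metric_triangle.
Qed.

Lemma dist1_eq0 x : closed K -> dist1 x = 0 -> K x.
Proof.
move=> cK x0; apply: cK => U; rewrite -nbhs_ballE => -[e /= e0 eU].
have e1 : 0 < Num.min e 1 by rewrite lt_min e0 ltr01.
have hi : has_inf [set r | r = 1 \/ exists2 y, K y & r = mdist x y].
  by split => //; exists 1; left.
have [r [->|[y Ky ->]]] := inf_adherent e1 hi.
  by rewrite -/(dist1 x) x0 add0r lt_min ltxx andbF.
rewrite -/(dist1 x) x0 add0r lt_min => /andP[xy _].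
by exists y; split => //; apply: eU; rewrite ballEmdist.
Qed.

Lemma open_dist1_lt r : open [set x | dist1 x < r].
Proof.
rewrite openE => x /= xr; rewrite /interior -nbhs_ballE.
exists (r - dist1 x); first by rewrite /= subr_gt0.
move=> y; rewrite ballEmdist /= => xy.
by apply: le_lt_trans (dist1_lip y x) _; rewrite metric_sym; lra.
Qed.

End Distance.

Section Boundary.
Context (d : measure_display) (T : measurableType d) (R : realType).
Variables (mu : probability T R) (f : T -> T).
Hypotheses (mf : measurable_fun setT f) (inv : invariant_measure mu f).
Variables (I : finType) (phi : I -> T -> R).
Hypothesis mphi : forall i r, measurable [set x | phi i x < r].

(** The level is thin for the distribution of all the [phi i], so the points with
    [`|phi i - rho| < s] have probability O(sqrt s): this is summable along
    [s = exp (- theta t)], and the Borel-Cantelli lemma applies. *)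
Lemma orbit_avoids_level (a b theta : R) : a < b -> 0 < theta ->
  exists2 rho, a < rho < b & {ae mu, forall x, exists2 C, 0 < C &
    forall t i, C * expR (- (theta * t%:R)) <= `|phi i (iter t f x) - rho|}.
Proof.
move=> ab th0.
have aux (j t l : R) : theta * t < (j + 1) * (2 * l) ->
    - (j * l) <= l + - (theta / 2) * t by lra.
pose Lt i (r : R) := [set x | phi i x < r].
pose m u v : R := \sum_i (pr mu (Lt i v) - pr mu (Lt i u)).
have [|x y z _ _|rho [rab Hrho]] := @exists_thin_level R m a b ab.
- move=> x y xy; apply: sumr_ge0 => i _; rewrite subr_ge0.
  by apply: le_pr; [exact: mphi|exact: mphi|move=> z /= /lt_le_trans; apply].
- by rewrite -big_split /=; apply: ler_sum => i _; lra.
exists rho => //.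
pose E (s : R) := \bigcup_(i in [set: I]) [set x | `|phi i x - rho| < s].
have Esub i (s : R) : [set x | `|phi i x - rho| < s] =
    (Lt i (rho + s) `\` ([set x | phi i x <= rho - s])).
  apply/seteqP; split => x; rewrite /Lt /= ltr_norml.
    by move=> /andP[h1 h2]; split; [lra|apply/negP; rewrite -ltNge; lra].
  by move=> [h1 /negP]; rewrite -ltNge => h2; apply/andP; split; lra.
have mle i (r : R) : measurable [set x | phi i x <= r].
  rewrite (_ : [set _ | _] = \bigcap_n Lt i (r + n.+1%:R^-1)).
    by apply: bigcapT_measurable => n; exact: mphi.
  apply/seteqP; split => x /= h.
    by move=> n _; rewrite /Lt /=; apply: le_lt_trans h _; rewrite ltrDl invr_gt0 ltr0n.
  apply/ler_addgt0Pr => e e0.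
  have h' := h (Num.truncn e^-1) Logic.I; apply/ltW/(lt_le_trans h'); rewrite lerD2l.
  by rewrite ltW// invf_plt ?posrE// truncnS_gt.
have mEi i (s : R) : measurable [set x | `|phi i x - rho| < s].
  by rewrite Esub; apply: measurableD => //; exact: mphi.
have mE s : measurable (E s) by apply: fin_bigcup_measurable => //; exact: finite_finset.
have prE_le s : 0 < s -> pr mu (E s) <= m (rho - s) (rho + s).
  move=> s0; apply: (@le_trans _ _ (\sum_i pr mu [set x | `|phi i x - rho| < s])).
    apply: pr_cover_le => // x [i _ Ei]; exists i => //; exact: mem_index_enum.
  apply: ler_sum => i _; rewrite lerBrDr.
  have dj : [disjoint [set x | `|phi i x - rho| < s] & Lt i (rho - s)].
    apply/disj_set2P; apply/seteqP; split => // x /= [].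
    by rewrite /Lt /= ltr_norml => /andP[h1 _] h2; move: h1 h2; lra.
  rewrite -(prU mu (mEi i s) (mphi i _) dj).
  apply: le_pr; [by apply: measurableU|exact: mphi|].
  move=> x [|] /=; rewrite /Lt /= ?ltr_norml; last by lra.
  by move=> /andP[_ h]; lra.
pose c0 := (b - a) / 4; have c00 : 0 < c0 by rewrite divr_gt0 ?subr_gt0.
pose s t := c0 * expR (- (theta * t%:R)).
have s0 t : 0 < s t by rewrite mulr_gt0 ?expR_gt0.
pose th := expR (- (theta / 2)).
have th01 : 0 <= th < 1 by rewrite expR_ge0 expR_lt1 oppr_lt0 divr_gt0.
have mab : 0 <= m a b.
  apply: sumr_ge0 => i _; rewrite subr_ge0; apply: le_pr; [exact: mphi|exact: mphi|].
  by move=> z /= /lt_le_trans; apply; exact: ltW.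
have prEs t : pr mu (E (s t)) <= (2 * m a b) * th ^+ t.
  have ln20 : 0 < ln 2 :> R by rewrite ln_gt0// ltr1n.
  pose j := Num.truncn (theta * t%:R / (2 * ln 2)).
  have [jt tj] : j%:R <= theta * t%:R / (2 * ln 2) /\
      theta * t%:R / (2 * ln 2) < j.+1%:R.
    by split; [rewrite truncn_le divr_ge0// mulr_ge0// ltW|exact: truncnS_gt].
  rewrite ler_pdivlMr ?mulr_gt0// in jt; rewrite ltr_pdivrMr ?mulr_gt0// in tj.
  have e4 : (4 : R) ^+ j = expR (j%:R * (2 * ln 2)).
    have -> : 4 = expR (ln 2 * 2) :> R.
      by rewrite expRM_natr lnK ?posrE// expr2; lra.
    by rewrite -expRM_natr; congr expR; lra.
  have e2 k : (2 : R) ^+ k = expR (k%:R * ln 2).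
    by rewrite -[2 in LHS]lnK ?posrE// -expRM_natr mulrC.
  have sj : s t <= (b - a) / 4 ^+ j.+1.
    rewrite /s /c0 exprS invfM mulrA ler_wpM2l//; first by rewrite ltW.
    by rewrite e4 -expRN ler_expR; lra.
  apply: le_trans (prE_le _ (s0 t)) _.
  apply: (@le_trans _ _ (m a b / 2 ^+ j)).
    apply: le_trans (Hrho j); apply: ler_sum => i _; apply: lerB.
      apply: le_pr; [exact: mphi|exact: mphi|].
      by move=> x /= /lt_le_trans; apply; rewrite lerD2l.
    apply: le_pr; [exact: mphi|exact: mphi|].
    by move=> x /= /lt_le_trans; apply; rewrite lerD2l lerN2.
  rewrite [2 * _]mulrC -mulrA ler_wpM2l// /th -expRM_natr e2.
  have : expR (- (j%:R * ln 2)) <= expR (ln 2) * expR (- (theta / 2) * t%:R).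
    rewrite -expRD ler_expR; move: tj; rewrite -natr1.
    exact: aux.
  by rewrite expRN lnK// posrE.
have mEf t u : measurable (iter t f @^-1` E u) by exact: measurable_preiter.
have prf t u : pr mu (iter t f @^-1` E u) = pr mu (E u) by rewrite /pr invariant_iter.
have h1 : {ae mu, forall x, exists n0, forall t, (n0 <= t)%N -> ~ (iter t f @^-1` E (s t)) x}.
  apply: (borel_cantelli_geometric (C := 2 * m a b) (theta := th)) => // t.
  by rewrite prf.
have h2 : {ae mu, forall x, forall t, exists n0, forall n, (n0 <= n)%N ->
    ~ (iter t f @^-1` E (s n)) x}.
  apply: ae_foralln => t.
  apply: (borel_cantelli_geometric (C := 2 * m a b) (theta := th)) => // n.
  by rewrite prf.
move: h1 h2; apply: filterS2 => x [n0 H1] H2.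
have notE t u : ~ (iter t f @^-1` E u) x -> forall i, u <= `|phi i (iter t f x) - rho|.
  by move=> nE i; rewrite leNgt; apply/negP => h; apply: nE; exists i.
have [C [C0 Cc HC]] : exists C, [/\ 0 < C, C <= c0 &
    forall t i, (t < n0)%N -> C <= `|phi i (iter t f x) - rho|].
  elim: (n0) => [|N [C [C0 Cc HC]]]; first by exists c0.
  have [n Hn] := H2 N.
  exists (Num.min C (s n)); split.
  - by rewrite lt_min C0 s0.
  - by rewrite ge_min Cc.
  move=> t i; rewrite ltnS leq_eqVlt => /predU1P[->|tN].
    rewrite ge_min; apply/orP; right; apply: notE; exact: Hn.
  by rewrite ge_min HC.
exists C => // t i; have [tn|nt] := ltnP t n0.
  apply: le_trans (HC t i tn); rewrite ler_piMr ?(ltW C0)//.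
  by rewrite -expR0 ler_expR oppr_le0 mulr_ge0// ltW.
apply: le_trans (notE _ _ (H1 t nt) i); rewrite /s ler_wpM2r ?expR_ge0//.
Qed.

End Boundary.

Section ThickObservable.
Context (R : realType) (X : pmetricType R) (f : X -> X).
Variable mu : probability (borel X) R.
Hypothesis mf : measurable_fun (setT : set (borel X)) (f : borel X -> borel X).
Hypothesis inv : invariant_measure mu f.

Lemma small_correction (gap K : R) : 0 < gap -> 1 <= K ->
  exists b eta, [/\ 0 < b < 1, 0 < eta & - ln (1 - b) + eta * ln (K / b) < gap].
Proof.
move=> gap0 K1; pose b := 1 - expR (- (Num.min gap 1 / 4)).
have g0 : 0 < Num.min gap 1 by rewrite lt_min gap0 ltr01.
have gg : Num.min gap 1 <= gap by rewrite ge_min lexx.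
have b0 : 0 < b by rewrite subr_gt0 expR_lt1 oppr_lt0 divr_gt0.
have b1 : b < 1 by rewrite ltrBlDl ltrDr expR_gt0.
have K0 : 0 < ln (K / b).
  by rewrite ln_gt0// ltr_pdivlMr// mul1r; apply: lt_le_trans K1.
exists b, (gap / 4 / ln (K / b)); split; [by rewrite b0 b1|by rewrite !divr_gt0|].
rewrite divfK ?gt_eqF//.
have -> : 1 - b = expR (- (Num.min gap 1 / 4)) by rewrite /b; lra.
by rewrite expRK; lra.
Qed.

(** Any entropy below that of the measure is reached by a finite observable whose
    atoms have boundaries that almost no orbit approaches at the exponential
    speed [theta].
    The atoms of a given partition are shrunk to closed sets of almost the same
    measure, then thickened to neighbourhoods of a common radius, a thin level
    of the distances to these closed sets. This changes the partition on a small
    event only, hence its entropy rate by little. *)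
Lemma thick_observable (c theta : R) : (c%:E < metric_entropy mu f)%E -> 0 < theta ->
  exists k (eta : borel X -> 'I_k),
    [/\ forall i, measurable (eta @^-1` [set i]), c < rate mu f eta &
      {ae mu, forall x, exists2 C, 0 < C &
        forall t (y : X), mdist (iter t f x : X) y < C * expR (- (theta * t%:R)) ->
          eta y = eta (iter t f x)}].
Proof.
move=> /(metric_entropy_approx mf inv)[k [xi [mxi cr]]] th0.
have k1 : 1 <= k%:R :> R.
  by rewrite ler1n; apply: leq_ltn_trans (ltn_ord (xi point)).
have [b [eta [b01 eta0 hb]]] : exists b eta, [/\ 0 < b < 1, 0 < eta &
    - ln (1 - b) + eta * ln (k%:R / b) < rate mu f xi - c].
  by apply: small_correction => //; rewrite subr_gt0.
pose e := eta / (2 * k%:R).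
have e0 : 0 < e by rewrite divr_gt0// mulr_gt0//; lra.
have /choice[K HK] : forall i, exists K : set X,
    [/\ closed K, K `<=` xi @^-1` [set i] & pr mu (xi @^-1` [set i] `\` K) < e].
  by move=> i; apply: inner_regular.
have cK i : closed (K i) by have [] := HK i.
have KP i : K i `<=` xi @^-1` [set i] by have [] := HK i.
pose phi i (x : borel X) := dist1 (K i) x.
have mphi i r : measurable [set x | phi i x < r].
  exact: (open_borel (@open_dist1_lt _ _ (K i) r)).
(* the collars of K i, which shrink to the empty set *)
pose Col i n := [set x | 0 < phi i x] `&` [set x | phi i x < n.+1%:R^-1].
have mpos i : measurable [set x | 0 < phi i x].
  rewrite (_ : [set _ | _] = ~` (K i : set (borel X))).
    by apply: measurableC; exact: closed_borel.
  apply/seteqP; split => x /=.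
    by move=> h Kx; rewrite /phi dist1_in ?ltxx in h.
  move=> nK; rewrite lt_neqAle dist1_ge0 andbT; apply/negP => /eqP/esym h.
  exact: nK (dist1_eq0 (cK i) h).
have mCol i n : measurable (Col i n) by apply: measurableI.
have /choice[N HN] : forall i, exists n, pr mu (Col i n) < e.
  move=> i; apply: pr_bigcup_decr => //.
    move=> n x [h1 h2]; split => //; apply: lt_le_trans h2 _.
    by rewrite lef_pV2 ?posrE ?ltr0n// ler_nat.
  rewrite (_ : \bigcap_n _ = set0) ?measure0//; apply/seteqP; split => // x H.
  have [/= h _] := H 0%N Logic.I; have [_ /=] := H (Num.truncn (phi i x)^-1) Logic.I.
  apply/negP; rewrite -leNgt ltW// invf_plt ?posrE// ?truncnS_gt//.
pose M := (\max_i N i)%N; pose rho1 : R := M.+1%:R^-1.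
have rho10 : 0 < rho1 by rewrite invr_gt0 ltr0n.
have [rho /andP[rho0 rho1r] Hrho] := orbit_avoids_level mf inv mphi rho10 th0.
pose nu (x : borel X) := odflt (xi point) [pick i | phi i x < rho].
have mnu i : measurable (nu @^-1` [set i]).
  have mfib (v : {ffun 'I_k -> bool}) :
      measurable [set x | forall j, (phi j x < rho) = v j].
    rewrite (_ : [set _ | _] = ~` \bigcup_(j in [set: 'I_k])
        (if v j then ~` [set x | phi j x < rho] else [set x | phi j x < rho])).
      apply: measurableC; apply: fin_bigcup_measurable; first exact: finite_finset.
      by move=> j _; case: (v j) => //; exact: measurableC.
    apply/seteqP; split => x /= H.
      by move=> [j _]; have := H j; case: (v j) => /= [-> //|/negbT/negP].
    move=> j; case: (boolP (v j)) => vj; last first.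
      by apply/negbTE/negP => h; apply: H; exists j; rewrite // (negbTE vj).
    by apply: contrapT => h; apply: H; exists j; rewrite // vj.
  rewrite (_ : _ @^-1` _ = \bigcup_(v in [set v : {ffun 'I_k -> bool} |
      odflt (xi point) [pick i | v i] = i]) [set x | forall j, (phi j x < rho) = v j]).
    by apply: fin_bigcup_measurable => //; exact: finite_finset.
  apply/seteqP; split => x /=.
    move=> nux; exists [ffun j => phi j x < rho]; last by move=> j; rewrite ffunE.
    by rewrite /= -nux /nu; congr odflt; apply: eq_pick => j; rewrite ffunE.
  move=> [v /= vi Hv]; rewrite -vi /nu; congr odflt; apply: eq_pick => j; exact: Hv.
exists k, nu; split => //; last first.
  move: Hrho; apply: filterS => x [C C0 HC]; exists C => // t y xy.
  rewrite /nu; congr odflt; apply: eq_pick => i.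
  have := HC t i; have h1 := dist1_lip (K i) (iter t f x) y.
  have := dist1_lip (K i) y (iter t f x); rewrite metric_sym => h2.
  rewrite /phi => h; have {h} : mdist (iter t f x : X) y < `|dist1 (K i) (iter t f x) - rho|.
    exact: lt_le_trans xy h.
  rewrite ltr_normr => h; apply/idP/idP => h'; move: h => /orP[]; lra.
have sub : [set x | xi x != nu x] `<=`
    \bigcup_(i in [set: 'I_k]) ((xi @^-1` [set i] `\` K i) `|` Col i (N i)).
  move=> x /= /eqP xinu; apply: contrapT => H; apply: xinu.
  have Kx : K (xi x) x.
    by apply: contrapT => nK; apply: H; exists (xi x) => //; left.
  have far j : j != xi x -> rho <= phi j x.
    move=> /eqP jx; rewrite leNgt; apply/negP => h; apply: H; exists j => //; right.
    split => /=.
      rewrite lt_neqAle dist1_ge0 andbT; apply/negP => /eqP/esym h0.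
      by apply: jx; rewrite -(KP j x)//; exact: dist1_eq0.
    apply: lt_le_trans h _; apply: le_trans (ltW rho1r) _.
    by rewrite lef_pV2 ?posrE ?ltr0n// ler_nat ltnS; exact: leq_bigmax.
  rewrite /nu; case: pickP => [j hj /=|/(_ (xi x))].
    by apply/esym/eqP; apply: contraTT hj => /far; rewrite -leNgt.
  by rewrite /phi dist1_in// rho0.
have mne : measurable [set x | xi x != nu x].
  rewrite (_ : [set _ | _] = \bigcup_(i in [set: 'I_k])
      ((xi @^-1` [set i]) `\` (nu @^-1` [set i]))).
    apply: fin_bigcup_measurable; first exact: finite_finset.
    by move=> i _; exact: measurableD.
  apply/seteqP; split => x /=; first by move=> /eqP h; exists (xi x) => //; split => // /esym.
  by move=> [i _ [/= <- h]]; apply/eqP => h'; apply: h; rewrite h'.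
have prne : pr mu [set x | xi x != nu x] <= eta.
  pose W i := (xi @^-1` [set i] `\` K i) `|` Col i (N i).
  have mW i : measurable (W i : set (borel X)).
    by apply: measurableU => //; apply: measurableD => //; exact: closed_borel.
  apply: (@le_trans _ _ (\sum_i pr mu (W i))).
    apply: pr_cover_le => // x /sub[i _ Wi]; exists i => //; exact: mem_index_enum.
  apply: (@le_trans _ _ (\sum_(i < k) (e + e))).
    apply: ler_sum => i _; apply: le_trans (prU_le _ _ _) _ => //.
      by apply: measurableD => //; exact: closed_borel.
    by apply: lerD; apply: ltW => //; have [] := HK i.
  rewrite sumr_const card_ord -[_ *+ k]mulr_natl /e.
  by rewrite (_ : k%:R * _ = eta)//; field; rewrite gt_eqF//; lra.
have := rate_compare mf inv mxi mnu b01; rewrite card_ord.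
have : pr mu [set x | xi x != nu x] * ln (k%:R / b) <= eta * ln (k%:R / b).
  rewrite ler_wpM2r// ln_ge0//; have [b0 b1] := andP b01.
  by rewrite ler_pdivlMr//; lra.
by move: hb; lra.
Qed.

End ThickObservable.

(** * Rates as limits along small radii *)

Section Rates.
Variable R : realType.
Implicit Types (g : R -> \bar R) (V : \bar R).

Lemma limf_einf_ge g V (r0 : R) : 0 < r0 ->
  (forall r, 0 < r < r0 -> (V <= g r)%E) -> (V <= limf_einf g (0 : R)^'+)%E.
Proof.
move=> r00 H; rewrite limf_einfE.
apply: (@le_trans _ _ (ereal_inf (g @` [set r | 0 < r < r0]))).
  by apply: le_ereal_inf_tmp => _ [r /= rr <-]; exact: H.
apply: ereal_sup_ubound; exists [set r | 0 < r < r0] => //.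
near=> r; rewrite /=; apply/andP; split; near: r.
  exact: nbhs_right_gt.
exact: nbhs_right_lt.
Unshelve. all: by end_near. Qed.

Lemma limf_esup_le g V (r0 : R) : 0 < r0 ->
  (forall r, 0 < r < r0 -> (g r <= V)%E) -> (limf_esup g (0 : R)^'+ <= V)%E.
Proof.
move=> r00 H; rewrite limf_esupE.
apply: (@le_trans _ _ (ereal_sup (g @` [set r | 0 < r < r0]))); last first.
  by apply: ge_ereal_sup => _ [r /= rr <-]; exact: H.
apply: ereal_inf_lbound; exists [set r | 0 < r < r0] => //.
near=> r; rewrite /=; apply/andP; split; near: r.
  exact: nbhs_right_gt.
exact: nbhs_right_lt.
Unshelve. all: by end_near. Qed.

(** The next two lemmas turn estimates at the scales [C * exp (- n q)] into
    estimates at all small radii, at the price of the gap between [a] and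
    [a']. *)
Lemma scale_below (q a a' C : R) (N : nat) : 0 < q -> 0 <= a -> a < a' -> 0 < C ->
  exists2 r0, 0 < r0 & forall r, 0 < r < r0 -> 0 < - ln r /\
    exists n, [/\ (N <= n)%N, r <= C * expR (- (q * n%:R)) &
      a / q * - ln r <= a' * n%:R].
Proof.
move=> q0 a0 aa' C0; pose l := ln C.
pose B := Num.max 1 (Num.max (q * N.+1%:R - l) (a' * (q - l) / (a' - a))).
exists (expR (- B)); first exact: expR_gt0.
move=> r /andP[r0 rB]; have lr : ln r < - B by rewrite -[- B]expRK ltr_ln// posrE expR_gt0.
have [B1 B2 B3] : [/\ 1 < - ln r, q * N.+1%:R - l < - ln r
    & a' * (q - l) / (a' - a) < - ln r].
  have lK : B < - ln r by lra.
  by split; apply: le_lt_trans lK; rewrite /B !le_max lexx ?orbT.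
have d0 : 0 < a' - a by rewrite subr_gt0.
rewrite ltr_pdivrMr// in B3.
split; first by lra.
pose n := Num.truncn ((l - ln r) / q).
have lq : 0 <= (l - ln r) / q.
  rewrite divr_ge0 ?(ltW q0)//; have : 0 <= q * N.+1%:R by rewrite mulr_ge0// ltW.
  by lra.
have [n1 n2] : n%:R * q <= l - ln r /\ l - ln r < n.+1%:R * q.
  by rewrite -ler_pdivlMr// -ltr_pdivrMr// truncn_le lq truncnS_gt.
exists n; split.
- rewrite -ltnS -(ltr_nat R) -(ltr_pM2r q0) mulrC; apply: le_lt_trans n2.
  by apply: ltW; rewrite -natr1 in B2 *; lra.
- rewrite -[leLHS]lnK ?posrE// -[C in leRHS]lnK ?posrE// -expRD ler_expR -/l.
  by lra.
rewrite mulrAC ler_pdivrMr//; rewrite -natr1 in n2; nra.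
Qed.

Lemma scale_above (q a a' B C : R) (N : nat) : 0 < q -> 0 <= a' -> a' < a -> 0 < C ->
  exists2 r0, 0 < r0 & forall r, 0 < r < r0 -> 0 < - ln r /\
    exists n, [/\ (N <= n)%N, C * expR (- (q * n%:R)) <= r &
      a' * n%:R + B <= a / q * - ln r].
Proof.
move=> q0 a0 aa' C0; pose l := ln C.
pose K := Num.max 1 (Num.max (q * N%:R - l) ((a' * (q + l) + B * q) / (a - a'))).
exists (expR (- K)); first exact: expR_gt0.
move=> r /andP[r0 rB]; have lr : ln r < - K by rewrite -[- K]expRK ltr_ln// posrE expR_gt0.
have [B1 B2 B3] : [/\ 1 < - ln r, q * N%:R - l < - ln r
    & (a' * (q + l) + B * q) / (a - a') < - ln r].
  have lK : K < - ln r by lra.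
  by split; apply: le_lt_trans lK; rewrite /K !le_max lexx ?orbT.
have d0 : 0 < a - a' by rewrite subr_gt0.
rewrite ltr_pdivrMr// in B3.
split; first by lra.
pose n := (Num.truncn ((l - ln r) / q)).+1.
have lq : 0 <= (l - ln r) / q.
  rewrite divr_ge0 ?(ltW q0)//; have : 0 <= q * N%:R by rewrite mulr_ge0// ltW.
  by lra.
have [n1 n2] : n.-1%:R * q <= l - ln r /\ l - ln r < n%:R * q.
  by rewrite -ler_pdivlMr// -ltr_pdivrMr// truncn_le lq truncnS_gt.
exists n; split.
- by rewrite -(ler_nat R) -(ler_pM2r q0); lra.
- rewrite -[leRHS]lnK ?posrE// -[C in leLHS]lnK ?posrE// -expRD ler_expR -/l.
  by lra.
have nE : n%:R = n.-1%:R + 1 :> R by rewrite natr1.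
rewrite mulrAC ler_pdivlMr// nE; nra.
Qed.

(** Reals below [h] that approach it, also when [h] is infinite. Almost sure
    bounds are proved along this sequence, since only countably many of them may
    be combined. *)
Definition approx_seq (h : \bar R) (n : nat) : R :=
  if h is r%:E then r * (1 - n.+2%:R^-1) else n.+1%:R.

Lemma approx_seq_gt0 h n : (0 < h)%E -> 0 < approx_seq h n.
Proof.
case: h => [r| |]//= r0; rewrite mulr_gt0 ?subr_gt0 ?invf_lt1 ?ltr1n//.
Qed.

Lemma approx_seq_lt h n : (0 < h)%E -> ((approx_seq h n)%:E < h)%E.
Proof.
case: h => [r| |]//= r0; last by rewrite ltry.
by rewrite lte_fin gtr_pMr// ltrBlDr ltrDl invr_gt0 ltr0n.
Qed.

Lemma quotient_le_lim (h V : \bar R) (l : R) : (0 < h)%E -> 0 <= l ->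
  (forall n, ((approx_seq h n / (l + n.+1%:R^-1))%:E <= V)%E) -> (h / l%:E <= V)%E.
Proof.
move=> h0 l0; case: V => [v| |]; [|by rewrite leey|by move=> /(_ 0%N)].
have q0 n : 0 < l + n.+1%:R^-1 by rewrite ltr_wpDl// invr_gt0 ltr0n.
have i1 n : n.+1%:R^-1 <= 1 :> R by rewrite invf_le1 ?ltr0n// ler1n.
move=> H; have {}H n : approx_seq h n <= v * (l + n.+1%:R^-1).
  by rewrite -ler_pdivrMr// -lee_fin.
have v0 : 0 < v.
  by have := lt_le_trans (approx_seq_gt0 0 h0) (H 0%N); rewrite pmulr_lgt0.
case: h h0 H => [h| |]//= h0 H; last first.
  exfalso; have := H (Num.truncn (v * (l + 1))).
  rewrite leNgt => /negP; apply; apply: le_lt_trans (truncnS_gt _).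
  by rewrite ler_wpM2l ?(ltW v0)// lerD2l i1.
have hvl : h <= v * l.
  apply/ler_addgt0Pr => e e0; pose n := Num.truncn ((h + v) / e).
  have hn := H n.
  have n2 : n.+2%:R^-1 <= n.+1%:R^-1 :> R by rewrite lef_pV2 ?posrE ?ltr0n// ler_nat.
  have h00 : 0 < h by rewrite -lte_fin.
  have : (h + v) * n.+1%:R^-1 < e.
    by rewrite ltr_pdivrMr ?ltr0n// mulrC -ltr_pdivrMr//; exact: truncnS_gt.
  have : h * n.+2%:R^-1 <= h * n.+1%:R^-1 by rewrite ler_wpM2l// ltW.
  move: hn; rewrite /approx_seq; move: (n.+2%:R^-1) (n.+1%:R^-1) => a b; lra.
have h00 : 0 < h by rewrite -lte_fin.
have l00 : 0 < l by have := lt_le_trans h00 hvl; rewrite pmulr_rgt0.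
by rewrite inver gt_eqF// lee_fin ler_pdivrMr.
Qed.

Lemma lim_le_quotient (h q : R) (V : \bar R) : 0 < q ->
  (forall n, (V <= ((h + n.+1%:R^-1) / q)%:E)%E) -> (V <= (h / q)%:E)%E.
Proof.
move=> q0 H; apply/lee_addgt0Pr => e e0.
apply: le_trans (H (Num.truncn (e * q)^-1)) _; rewrite -EFinD lee_fin mulrDl lerD2l.
by rewrite ler_pdivrMr// ltW// invf_plt ?posrE ?mulr_gt0// truncnS_gt.
Qed.

End Rates.

(** * Recurrence of balls *)

Section ReturnTimes.
Context (R : realType) (X : metricType R) (f : X -> X).
Implicit Types (x : X) (r V : R).

Lemma le_lne (u v : \bar R) : (u <= v)%E -> (lne u <= lne v)%E.
Proof.
case: u => [u| |]; case: v => [v| |] //=; rewrite ?leey ?leNye//.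
rewrite lee_fin => uv; case: (leP u 0) => u0; first by rewrite leNye.
by have v0 := lt_le_trans u0 uv; rewrite (leNgt v 0) v0 /= lee_fin ler_ln.
Qed.

Lemma recurrence_ratio_ge x r V : 0 < - ln r ->
  (forall m, (1 <= m)%N -> ball x r (iter m f x) -> expR (V * - ln r) <= m%:R) ->
  (V%:E <= recurrence_ratio f x r)%E.
Proof.
move=> lr H; rewrite /recurrence_ratio inver gt_eqF// lee_pdivlMr//.
rewrite -EFinM -[(V * _)%:E](_ : lne (expR (V * - ln r))%:E = _); last first.
  by rewrite lne_EFin ?expR_gt0// expRK.
apply: le_lne; apply: le_ereal_inf_tmp => _ [m [m1 Bm] <-].
by rewrite lee_fin; exact: H.
Qed.

Lemma recurrence_ratio_le x r V m : 0 < - ln r -> (1 <= m)%N ->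
  ball x r (iter m f x) -> m%:R <= expR (V * - ln r) ->
  (recurrence_ratio f x r <= V%:E)%E.
Proof.
move=> lr m1 Bm mV; rewrite /recurrence_ratio inver gt_eqF// lee_pdivrMr//.
rewrite -EFinM -[(V * _)%:E](_ : lne (expR (V * - ln r))%:E = _); last first.
  by rewrite lne_EFin ?expR_gt0// expRK.
apply: le_lne; apply: (@le_trans _ _ (m%:R)%:E); last by rewrite lee_fin.
by apply: ereal_inf_lbound; exists m.
Qed.

Lemma set_recurrence_ratio_ge x r V : 0 < - ln r ->
  (forall k y, (1 <= k)%N -> ball x r y -> ball x r (iter k f y) ->
     V * - ln r <= k%:R) ->
  (V%:E <= set_recurrence_ratio f x r)%E.
Proof.
move=> lr H; rewrite /set_recurrence_ratio inver gt_eqF// lee_pdivlMr// -EFinM.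
apply: le_ereal_inf_tmp => _ [k [k1 [y [yk y0]]] <-].
by rewrite lee_fin; exact: H y0 yk.
Qed.

Lemma set_recurrence_ratio_le x r V k y : 0 < - ln r -> (1 <= k)%N ->
  ball x r y -> ball x r (iter k f y) -> k%:R <= V * - ln r ->
  (set_recurrence_ratio f x r <= V%:E)%E.
Proof.
move=> lr k1 y0 yk kV; rewrite /set_recurrence_ratio inver gt_eqF// lee_pdivrMr// -EFinM.
apply: (@le_trans _ _ (k%:R)%:E); last by rewrite lee_fin.
by apply: ereal_inf_lbound; exists k => //; split => //; exists y.
Qed.

End ReturnTimes.

Section AlmostEverywhere.
Context (d : measure_display) (T : measurableType d) (R : realType).
Variable mu : probability T R.

(* filterS and filterS2 in a form that also applies to an almost everywhere
   statement whose variable is declared in a type only convertible to [T] *)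
Lemma ae_imply (P Q : T -> Prop) : (forall x, P x -> Q x) ->
  {ae mu, forall x, P x} -> {ae mu, forall x, Q x}.
Proof. by move=> PQ; apply: filterS. Qed.

Lemma ae_imply2 (P Q S : T -> Prop) : (forall x, P x -> Q x -> S x) ->
  {ae mu, forall x, P x} -> {ae mu, forall x, Q x} -> {ae mu, forall x, S x}.
Proof. by move=> PQ; apply: filterS2. Qed.

End AlmostEverywhere.

Section BallRecurrence.
Context (R : realType) (X : pmetricType R) (f : X -> X).
Variables (delta : R) (mu : probability (borel X) R).
Hypothesis f_cont : continuous f.
Hypothesis delta_gt0 : 0 < delta.
Hypothesis inv : invariant_measure mu f.
Hypothesis erg : ergodic_measure mu f.

Lemma continuous_borel : measurable_fun (setT : set (borel X)) (f : borel X -> borel X).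
Proof.
apply: (@measurability _ _ (borel X) (borel X) setT f (@open X)) => //.
move=> _ [U oU <-]; rewrite setTI; apply: open_borel.
by move/continuousP: f_cont; apply.
Qed.
Let mf := continuous_borel.

Section Expansion.
Variable lam : R.
Hypothesis lam_gt1 : 1 < lam.
Hypothesis f_expand : forall x y : X, mdist x y < delta ->
  lam * mdist x y <= mdist (f x) (f y).

(** An expanding map separates two orbits that stay [delta]-close for [n] steps by
    a factor [lam ^ n]. *)
Lemma bowen_ball n x y :
  (forall j, (j <= n)%N -> mdist (iter j f x) (iter j f y) < delta) ->
  mdist x y < delta * expR (- (ln lam * n%:R)).
Proof.
have lam0 : 0 < lam := lt_trans ltr01 lam_gt1.
move=> H; have h : lam ^+ n * mdist x y < delta.
  apply: le_lt_trans (H n (leqnn n)).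
  elim: n H => [|n IH] H; first by rewrite expr0 mul1r.
  rewrite exprS -mulrA; apply: (@le_trans _ _ (lam * mdist (iter n f x) (iter n f y))).
    by rewrite ler_pM2l// IH// => j jn; apply: H; exact: leqW.
  by apply: f_expand; apply: H; exact: leqW.
rewrite expRN expRM_natr lnK ?posrE// ltr_pdivlMr ?exprn_gt0//.
by rewrite mulrC.
Qed.

(** The specification property closes the orbit segment of length [n] of [x] into
    a periodic orbit of period [n + N], with [N] independent of [n]. *)
Lemma specification_upper : specification_property f ->
  forall x, (upper_minimal_recurrence_rate f x <= (1 / ln lam)%:E)%E.
Proof.
move=> spec x; have q0 : 0 < ln lam by rewrite ln_gt0.
apply: lim_le_quotient => // i.
have [N [N1 HN]] := spec delta delta_gt0.
have i0 : 0 < i.+1%:R^-1 :> R by rewrite invr_gt0 ltr0n.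
have [|||r0 r00 Hr] := @scale_above R (ln lam) (1 + i.+1%:R^-1) 1 N%:R delta 0%N q0.
- by [].
- by rewrite ltrDl.
- exact: delta_gt0.
apply: (limf_esup_le r00) => r /Hr[lr [n [_ nr nV]]].
have [|||y [yp yx]] := HN 1%N (fun=> x) (fun=> 0%N) (fun=> n) (n + N)%N isT erefl.
- by move=> [|[|k]].
- by move=> [|[|k]].
- by [].
have xy : ball x r y.
  rewrite ballEmdist /=; apply: lt_le_trans nr; apply: bowen_ball => j jn.
  by rewrite metric_sym; apply: (yx 1%N).
apply: (@set_recurrence_ratio_le _ _ f x r _ (n + N) y) => //.
- by rewrite addn_gt0 N1 orbT.
- by rewrite yp.
- by rewrite natrD -[n%:R]mul1r.
Qed.

Hypothesis X_compact : compact [set: X].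

(** [xi x] is the position of the first ball of a finite cover that contains
    [x]. *)
Lemma fine_observable : exists k (xi : borel X -> 'I_k),
  (forall i, measurable (xi @^-1` [set i])) /\
  forall x y : X, xi x = xi y -> mdist x y < delta.
Proof.
have d2 : 0 < delta / 2 by rewrite divr_gt0.
move: X_compact; rewrite compact_cover => /(_ X setT (fun c => ball c (delta / 2))).
case=> [c _|x _|D _ cD]; first exact: open_mball.
  by exists x => //; exact: ballxx.
pose s : seq X := finmap.enum_fset D; pose k := size s.
pose xi (x : borel X) : 'I_k.+1 :=
  inord (find (fun c => `[< ball c (delta / 2) x >]) s).
have hs (x : X) : has (fun c => `[< ball c (delta / 2) x >]) s.
  by have [c cD' xc] := cD x I; apply/hasP; exists c => //; exact/asboolP.
have xiE x : nat_of_ord (xi x) = find (fun c => `[< ball c (delta / 2) x >]) s.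
  by rewrite inordK// ltnS find_size.
have xiB x : ball (nth point s (xi x)) (delta / 2) x.
  by rewrite xiE; apply/asboolP; exact: (nth_find point (hs x)).
exists k.+1, xi; split => [i|x y xy].
  have mb c : measurable (ball c (delta / 2) : set (borel X)).
    by apply: open_borel; exact: open_mball.
  have mlt j : measurable [set x : borel X |
      has (fun c => `[< ball c (delta / 2) x >]) (take j s)].
    rewrite (_ : [set _ | _] = \bigcup_(c in [set` take j s]) ball c (delta / 2)).
      by apply: fin_bigcup_measurable; [exact: finite_seq|move=> c _; exact: mb].
    apply/seteqP; split => x /=.
      by move=> /hasP[c cs /asboolP]; exists c.
    by move=> [c cs xc]; apply/hasP; exists c => //; exact/asboolP.
  rewrite (_ : _ @^-1` _ = [set x : borel X |
      has (fun c => `[< ball c (delta / 2) x >]) (take i.+1 s)] `\`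
      [set x : borel X | has (fun c => `[< ball c (delta / 2) x >]) (take i s)]).
    by apply: measurableD; exact: mlt.
  apply/seteqP; split => x /=; rewrite !has_take ?hs// -xiE.
    by move=> ->; rewrite ltnS leqnn ltnn.
  by move=> [xi1 /negP]; rewrite -leqNgt => xi2; apply/val_inj/eqP; rewrite eqn_leq xi2 andbT.
have := xiB y; rewrite -xy => yB; have := xiB x.
move: yB; rewrite !ballEmdist /= => h1 h2.
apply: le_lt_trans (metric_triangle x (nth point s (xi x)) y) _.
by rewrite [mdist x _]metric_sym; lra.
Qed.

(** A return to the cylinder of length [n] of an observable with atoms of diameter
    less than [delta] is a return to the ball of radius of order [lam ^ (- n)]. *)
Lemma expanding_upper (h : R) : metric_entropy mu f = h%:E ->
  {ae mu, forall x : X, (upper_recurrence_rate f x <= (h / ln lam)%:E)%E}.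
Proof.
move=> hE; have q0 : 0 < ln lam by rewrite ln_gt0.
have [k [xi [mxi Hxi]]] := fine_observable.
have rh : rate mu f xi <= h.
  by rewrite -lee_fin -hE; exact: rate_le_metric_entropy.
have r0 := rate_ge0 mf inv mxi.
suff H i : {ae mu, forall x : X,
    (upper_recurrence_rate f x <= ((h + i.+1%:R^-1) / ln lam)%:E)%E}.
  by apply: (ae_imply _ (ae_foralln H)) => x Hx; exact: lim_le_quotient.
have i0 : 0 < i.+1%:R^-1 :> R by rewrite invr_gt0 ltr0n.
move: (i.+1%:R^-1) i0 => e e0; pose s := h + e / 2.
have rs : rate mu f xi < s by rewrite /s; lra.
apply: (ae_imply _ (eventually_returns mf inv erg mxi rs)) => x [n0 Hn].
have lam0 : 0 < lam := lt_trans ltr01 lam_gt1.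
pose C := delta * lam; have C0 : 0 < C by rewrite mulr_gt0.
have [||//|r1 r10 Hr] := @scale_above R (ln lam) (h + e) s 0 C n0.+1 q0.
- by rewrite /s; lra.
- by rewrite /s; lra.
apply: (limf_esup_le r10) => r /Hr[lr [n [n0n nr nV]]].
have [m [m1 ms me]] := Hn n (ltnW n0n).
apply: (@recurrence_ratio_le _ _ f x r _ m) => //; last first.
  by apply: le_trans ms _; rewrite ler_expR; lra.
rewrite ballEmdist /=; apply: lt_le_trans nr.
case: n n0n nV ms me => [//|n] _ _ _ me.
have -> : C * expR (- (ln lam * n.+1%:R)) = delta * expR (- (ln lam * n%:R)).
  rewrite /C -mulrA; congr (_ * _); rewrite -{1}(lnK (x := lam)) ?posrE//.
  by rewrite -expRD -natr1; congr expR; lra.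
apply: bowen_ball => j jn; apply: Hxi.
by move/eq_itinP : me => /(_ j); rewrite ltnS => /(_ jn).
Qed.

End Expansion.

Section Lipschitz.
Variables (Lam : R).
Hypothesis Lam_gt0 : 0 < Lam.
Hypothesis f_lip : forall x y : X, mdist x y < delta ->
  mdist (f x) (f y) <= Lam * mdist x y.
Hypothesis entropy_gt0 : (0 < metric_entropy mu f)%E.

Let l := Num.max (ln Lam) 0.

Let l0 : 0 <= l.
Proof. by rewrite le_max lexx orbT. Qed.

(** Along [n] steps the ball of radius [C * exp (- q n)] around [x] grows by a
    factor [exp l] at each step, and so stays within the distance
    [C * exp (- (q - l) t)] of the orbit of [x] that the boundaries respect. *)
Lemma ball_sub_cylinder k (eta : borel X -> 'I_k) (q C : R) (x y : X) n :
  l < q -> 0 < C -> C <= delta ->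
  (forall t y, mdist (iter t f x : X) y < C * expR (- ((q - l) * t%:R)) ->
     eta y = eta (iter t f x)) ->
  mdist x y < C * expR (- (q * n%:R)) -> itin f eta n y = itin f eta n x.
Proof.
move=> lq C0 Cd HC xy; have q0 : 0 < q := le_lt_trans l0 lq.
have key j : (j <= n)%N ->
    mdist (iter j f x) (iter j f y) < C * expR (l * j%:R - q * n%:R).
  elim: j => [|j IH] jn; first by rewrite mulr0 sub0r.
  have {}IH := IH (ltnW jn).
  have small : mdist (iter j f x) (iter j f y) < delta.
    apply: lt_le_trans IH _; apply: le_trans Cd; rewrite ler_piMr ?(ltW C0)//.
    rewrite -[leRHS]expR0 ler_expR subr_le0; apply: (@le_trans _ _ (l * n%:R)).
      by rewrite ler_wpM2l// ler_nat ltnW.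
    by rewrite ler_wpM2r// ltW.
  apply: le_lt_trans (f_lip small) _.
  apply: (@le_lt_trans _ _ (expR l * mdist (iter j f x) (iter j f y))).
    rewrite ler_wpM2r ?mdist_ge0// -[leLHS]lnK ?posrE// ler_expR.
    by rewrite le_max lexx.
  rewrite -natr1 mulrDr mulr1 (_ : l * j%:R + l - q * n%:R = l + (l * j%:R - q * n%:R)); last by lra.
  by rewrite expRD mulrCA ltr_pM2l ?expR_gt0.
apply/eq_itinP => j jn; apply: HC.
apply: lt_le_trans (key j (ltnW jn)) _; rewrite ler_wpM2l ?(ltW C0)// ler_expR.
have : q * j%:R <= q * n%:R by rewrite ler_wpM2l ?(ltW q0)// ler_nat ltnW.
by lra.
Qed.

Lemma lipschitz_lower (c q : R) : 0 < c -> (c%:E < metric_entropy mu f)%E -> l < q ->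
  {ae mu, forall x : X, ((c / q)%:E <= lower_recurrence_rate f x)%E}.
Proof.
move=> c0 ch lq; have q0 : 0 < q := le_lt_trans l0 lq.
have [c' cc' c'h] : exists2 c', c < c' & (c'%:E < metric_entropy mu f)%E.
  move: ch; case: (metric_entropy mu f) => [h| |]//; last first.
    by move=> _; exists (c + 1); rewrite ?ltry// ltrDl.
  by rewrite lte_fin => ch; exists ((c + h) / 2); rewrite ?lte_fin; lra.
have th0 : 0 < q - l by rewrite subr_gt0.
have [k [eta [meta cr Heta]]] := thick_observable mf inv c'h th0.
have cr' : 0 <= c' < rate mu f eta by rewrite cr andbT; lra.
apply: (ae_imply2 _ Heta (eventually_no_return mf inv erg meta cr')) => x.
move=> [C C0 HC] [n0 Hn].
pose C' := Num.min C delta.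
have C'0 : 0 < C' by rewrite lt_min C0.
have [r0 r00 Hr] := scale_below n0 q0 (ltW c0) cc' C'0.
apply: (limf_einf_ge r00) => r /Hr[lr [n [n0n rn nV]]].
apply: recurrence_ratio_ge => // m m1; rewrite ballEmdist /= => xm.
rewrite leNgt; apply/negP => mV; apply: (Hn n n0n m m1).
  by apply: le_trans (ltW mV) _; rewrite ler_expR.
apply: (@ball_sub_cylinder k eta q C') => //.
- by rewrite ge_min lexx orbT.
- move=> t y xy; apply: HC; apply: lt_le_trans xy _.
  by rewrite ler_wpM2r ?expR_ge0// ge_min lexx.
- exact: lt_le_trans xm rn.
Qed.

Lemma lipschitz_lower_minimal (a q : R) : 0 < a < 1 -> l < q ->
  {ae mu, forall x : X, ((a / q)%:E <= lower_minimal_recurrence_rate f x)%E}.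
Proof.
move=> /andP[a0 a1] lq; have q0 : 0 < q := le_lt_trans l0 lq.
pose a' := (a + 1) / 2; have aa' : a < a' by rewrite /a'; lra.
have a'01 : 0 <= a' < 1 by apply/andP; rewrite /a'; split; lra.
have th0 : 0 < q - l by rewrite subr_gt0.
have [k [eta [meta cr Heta]]] := thick_observable mf inv entropy_gt0 th0.
apply: (ae_imply2 _ Heta (eventually_no_overlap mf inv erg meta a'01 cr)) => x.
move=> [C C0 HC] [n0 Hn].
pose C' := Num.min C delta.
have C'0 : 0 < C' by rewrite lt_min C0.
have sub n y : mdist x y < C' * expR (- (q * n%:R)) -> itin f eta n y = itin f eta n x.
  apply: ball_sub_cylinder => //; first by rewrite ge_min lexx orbT.
  move=> t z xz; apply: HC; apply: lt_le_trans xz _.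
  by rewrite ler_wpM2r ?expR_ge0// ge_min lexx.
have [r0 r00 Hr] := scale_below n0 q0 (ltW a0) aa' C'0.
apply: (limf_einf_ge r00) => r /Hr[lr [n [n0n rn nV]]].
apply: set_recurrence_ratio_ge => // j y j1; rewrite !ballEmdist /= => xy xjy.
rewrite leNgt; apply/negP => jV.
have ja : j%:R <= a' * n%:R by rewrite (le_trans (ltW jV)).
have jn : (j <= n)%N.
  rewrite -(ler_nat R) (le_trans ja)// ler_piMl//; lra.
apply: (Hn n n0n j j1 ja).
have e1 := sub n y (lt_le_trans xy rn).
have e2 := sub n (iter j f y) (lt_le_trans xjy rn).
rewrite -(drop_itin f eta x jn) -e1 drop_itin//.
by rewrite -(take_itin f eta (iter j f y) (leq_subr j n)) e2 take_itin// leq_subr.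
Qed.

End Lipschitz.

End BallRecurrence.

(** For [Lam < 1] the quotient is negative and the rate is not; for [Lam = 1] it is
    infinite, and so is the rate by the bounds for all constants above 1. *)
Lemma quotient_le_lim_ln (R : realType) (h V : \bar R) (Lam : R) : (0 < h)%E ->
  (forall n, ((approx_seq h n / (Num.max (ln Lam) 0 + n.+1%:R^-1))%:E <= V)%E) ->
  (h / (ln Lam)%:E <= V)%E.
Proof.
move=> h0 H; have l0 : 0 <= Num.max (ln Lam) 0 by rewrite le_max lexx orbT.
have := quotient_le_lim h0 l0 H; case: (leP 0 (ln Lam)) => // Lam0 _.
apply: (@le_trans _ _ 0%E).
  rewrite inver lt_eqF// mule_ge0_le0 ?(ltW h0)// lee_fin invr_le0 ltW//.
apply: le_trans (H 0%N); rewrite lee_fin divr_ge0//.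
  by rewrite ltW// approx_seq_gt0.
by rewrite addr_ge0.
Qed.

Theorem proposition1 (R : realType) (X : pmetricType R) (f : X -> X)
    (delta lam Lam : R) (mu : probability (borel X) R)
    (X_compact : compact [set: X])
    (f_continuous : continuous f)
    (delta_gt0 : 0 < delta) (lam_gt0 : 0 < lam) (Lam_gt0 : 0 < Lam)
    (f_bounds : forall x y : X, mdist x y < delta ->
       lam * mdist x y <= mdist (f x) (f y) /\
       mdist (f x) (f y) <= Lam * mdist x y)
    (mu_invariant : invariant_measure mu f)
    (mu_ergodic : ergodic_measure mu f)
    (entropy_gt0 : (0 < metric_entropy mu f)%E) :
  [/\ {ae mu, forall x : X,
         (metric_entropy mu f / (ln Lam)%:E <= lower_recurrence_rate f x)%E},
      (* for lam < 1 the quotient by log lam is negative and the literal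
         bound fails; the upper bounds are read with log lam > 0 *)
      1 < lam ->
      {ae mu, forall x : X,
         (upper_recurrence_rate f x <= metric_entropy mu f / (ln lam)%:E)%E},
      {ae mu, forall x : X,
         (1 / (ln Lam)%:E <= lower_minimal_recurrence_rate f x)%E} &
      specification_property f -> 1 < lam ->
      {ae mu, forall x : X,
         (upper_minimal_recurrence_rate f x <= 1 / (ln lam)%:E)%E}].
Proof.
have f_expand x y : mdist x y < delta -> lam * mdist x y <= mdist (f x) (f y).
  by move=> /f_bounds[].
have f_lip x y : mdist x y < delta -> mdist (f x) (f y) <= Lam * mdist x y.
  by move=> /f_bounds[].
have above n : Num.max (ln Lam) 0 < Num.max (ln Lam) 0 + n.+1%:R^-1.
  by rewrite ltrDl invr_gt0 ltr0n.
split.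
- have H n := lipschitz_lower f_continuous delta_gt0 mu_invariant mu_ergodic
    Lam_gt0 f_lip (approx_seq_gt0 n entropy_gt0) (approx_seq_lt n entropy_gt0)
    (above n).
  by apply: (ae_imply _ (ae_foralln H)) => x; exact: quotient_le_lim_ln.
- move=> lam1; have q0 : 0 < ln lam by rewrite ln_gt0.
  case hE : (metric_entropy mu f) entropy_gt0 => [h| |]// _.
    have := expanding_upper f_continuous delta_gt0 mu_invariant mu_ergodic lam1
      f_expand X_compact hE.
    by apply: ae_imply => x; rewrite inver gt_eqF.
  by apply: aeW => x; rewrite inver gt_eqF// gt0_mulye ?leey// lte_fin invr_gt0.
- have e1 : (0 < 1%:E :> \bar R)%E by [].
  have H n : {ae mu, forall x : X,
      ((approx_seq 1%:E n / (Num.max (ln Lam) 0 + n.+1%:R^-1))%:E <=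
        lower_minimal_recurrence_rate f x)%E}.
    apply: (lipschitz_lower_minimal f_continuous delta_gt0 mu_invariant
      mu_ergodic Lam_gt0 f_lip entropy_gt0 _ (above n)).
    by rewrite approx_seq_gt0// -lte_fin approx_seq_lt.
  by apply: (ae_imply _ (ae_foralln H)) => x; exact: quotient_le_lim_ln.
- move=> spec lam1; apply: aeW => x; have q0 : 0 < ln lam by rewrite ln_gt0.
  have := specification_upper delta_gt0 lam1 f_expand spec x.
  by rewrite inver gt_eqF// -EFinM mul1r.
Qed.
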